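(* Let $k>2$ and suppose $\frac{k^2-k}{2}\not\equiv 0\pmod p$. Then each translation-invariant $p$-adic Gibbs measure (TIpGM) of the $q$-state $p$-adic Potts model on the Cayley tree of order $k$ corresponds to a solution of the equation $$z=\left(\frac{(\theta+m-1)z+q-m}{mz+q-m-1+\theta}\right)^k \qquad( * )$$ with some integer $m$, $1\le m\le[q/2]$; that is, it equals $\mu_{h\mathbf 1_M}$ for some $M\subset\{1,\dots,q\}$ with $|M|=m$ and some solution $z=\exp_p(h)\in\mathcal E_p$ of $( * )$. Moreover, for a given $m\le[q/2]$, a fixed solution $z=\exp_p(h)\in\mathcal E_p$ of $( * )$ generates $\binom{q}{m}$ vectors $\tilde h=h\mathbf 1_M$ ($M\subset\{1,\dots,q\}$, $|M|=m$), giving $\binom{q}{m}$ TIpGMs $\mu_{h\mathbf 1_M}$.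
   Context: $p$ is a prime, $\mathbb Q_p$ the field of $p$-adic numbers with norm $|\cdot|_p$, $\mathcal E_p=\{x\in\mathbb Q_p:|x|_p=1,\ |x-1|_p<p^{-1/(p-1)}\}$; $[a]$ is the integer part of $a$. Cayley tree: $\Gamma^k=(V,L)$ is the infinite tree in which every vertex has exactly $k+1$ neighbours; $x^0\in V$ is a fixed root, $d$ the graph distance, $W_n=\{x\in V:d(x,x^0)=n\}$, $V_n=\bigcup_{m=0}^nW_m$. Potts model: spins take values in $\Phi=\{1,\dots,q\}$, $q\ge2$; the Hamiltonian is $H(\sigma)=J\sum_{\langle x,y\rangle\in L}\delta_{\sigma(x)\sigma(y)}$ with $J\in\mathbb Q_p$, $|J|_p<p^{-1/(p-1)}$, and $\theta=\exp_p(J)$. $H_n$ is the restriction of $H$ to $V_n$. $p$-adic Gibbs measure: a $p$-adic measure is a finitely additive $\mathbb Q_p$-valued function on an algebra of sets; it is a probability measure if the total mass is $1$. Given vectors $\tilde h_x=(\tilde h_{1,x},\dots,\tilde h_{q,x})\in\mathbb Q_p^q$, $x\in V$ (with entries in the domain of convergence of $\exp_p$), put $$\mu^{(n)}_{\tilde h}(\sigma_n)=Z_{n,\tilde h}^{-1}\exp_p\Big\{H_n(\sigma_n)+\sum_{x\in W_n}\tilde h_{\sigma_n(x),x}\Big\},\qquad \sigma_n\in\Phi^{V_n},$$ where $Z_{n,\tilde h}$ is the (nonzero) normalizing factor. If these are compatible, i.e. $\sum_{\omega_n\in\Phi^{W_n}}\mu^{(n)}_{\tilde h}(\sigma_{n-1}\vee\omega_n)=\mu^{(n-1)}_{\tilde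 h}(\sigma_{n-1})$ for all $n\ge1$ and $\sigma_{n-1}\in\Phi^{V_{n-1}}$ ($\vee$ is concatenation), they define a unique $p$-adic probability measure $\mu_{\tilde h}$ on the algebra of cylinder sets of $\Phi^V$, called a $p$-adic Gibbs measure. It is translation-invariant (a TIpGM) if the reduced vectors $h_x=(\tilde h_{i,x}-\tilde h_{q,x})_{i=1}^{q-1}$ do not depend on $x\in V$. For $M\subset\{1,\dots,q\}$, $\mathbf 1_M=(e_1,\dots,e_q)$ with $e_i=1$ if $i\in M$ and $e_i=0$ otherwise; $\mu_{h\mathbf 1_M}$ is the measure $\mu_{\tilde h}$ with $\tilde h_x=h\mathbf 1_M$ for all $x\in V$.
   Formalization: Translation invariance and h̃_x = h1_M are required only for x ≠ x^0 (the root has k+1 successors); the counts C(q,m) are claimed for z ≠ 1; existence of the measures assumes the base of the k-th power in ( * ) lies in E_p and the normalizing factors Z_n (n ≥ 1) are nonzero. *)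

(* Defs.v *)
From HB Require Import structures.
From mathcomp Require Import all_boot all_order all_algebra finmap.
From mathcomp Require Import mathcomp_extra boolp classical_sets functions.
From mathcomp Require Import cardinality reals exp.
From mathcomp Require Import ring_quotient zify ring.

Set Implicit Arguments.
Unset Strict Implicit.
Unset Printing Implicit Defensive.

Import Order.TTheory GRing.Theory Num.Theory.

Local Open Scope ring_scope.

Definition rat_padic_abs (p : nat) (x : rat) : rat :=
  if x == 0 then 0
  else p%:Q ^ ((logn p `|denq x|%N)%:Z - (logn p `|numq x|%N)%:Z).

Section RatPadicAbs.
Variables (p : nat) (hp : prime p).
Local Notation abs := (rat_padic_abs p).

Let p_gt0 : 0 < p%:Q. Proof. by rewrite ltr0n prime_gt0. Qed.
Let p_neq0 : p%:Q != 0. Proof. by rewrite gt_eqF// p_gt0. Qed.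
Let p_ge1 : 1 <= p%:Q. Proof. by rewrite ler1n prime_gt0. Qed.

Lemma rat_padic_abs0 : abs 0 = 0. Proof. by rewrite /rat_padic_abs eqxx. Qed.

Lemma rat_padic_absE (a b : int) : a != 0 -> b != 0 ->
  abs (a%:Q / b%:Q) = p%:Q ^ ((logn p `|b|%N)%:Z - (logn p `|a|%N)%:Z).
Proof.
move=> a0 b0; rewrite /rat_padic_abs.
have q0 : a%:Q / b%:Q != 0 by rewrite mulf_neq0 ?invr_eq0 ?intr_eq0.
rewrite (negbTE q0); set x := _ / _ in q0 *.
have /eqP : a%:Q * (denq x)%:Q = (numq x)%:Q * b%:Q.
  by apply/eqP; rewrite -eqr_div ?intr_eq0 ?denq_eq0// divq_num_den.
rewrite -!intrM eqr_int => /eqP /(congr1 absz); rewrite !abszM.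
move=> /(congr1 (logn p)); rewrite !lognM ?absz_gt0 ?denq_eq0 ?numq_eq0// => e.
by congr (_ ^ _); lia.
Qed.

Lemma rat_padic_abs_gt0 x : x != 0 -> 0 < abs x.
Proof. by move=> x0; rewrite /rat_padic_abs (negbTE x0) exprz_gt0. Qed.

Lemma rat_padic_abs_ge0 x : 0 <= abs x.
Proof.
by have [->|/rat_padic_abs_gt0/ltW//] := eqVneq x 0; rewrite rat_padic_abs0.
Qed.

Lemma rat_padic_abs1 : abs 1 = 1.
Proof. by rewrite -[1 in LHS]divr1 (@rat_padic_absE 1 1)// logn1 subrr. Qed.

Lemma rat_padic_absM x y : abs (x * y) = abs x * abs y.
Proof.
have [->|x0] := eqVneq x 0; first by rewrite mul0r rat_padic_abs0 mul0r.
have [->|y0] := eqVneq y 0; first by rewrite mulr0 rat_padic_abs0 mulr0.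
rewrite -{1}(divq_num_den x) -{1}(divq_num_den y) mulf_div -!intrM.
rewrite rat_padic_absE ?mulf_neq0 ?denq_eq0 ?numq_eq0//.
rewrite /rat_padic_abs (negbTE x0) (negbTE y0) -expfzDr// !abszM.
rewrite !lognM ?absz_gt0 ?denq_eq0 ?numq_eq0//.
by congr (_ ^ _); lia.
Qed.

Lemma rat_padic_absN x : abs (- x) = abs x.
Proof. by rewrite /rat_padic_abs oppr_eq0 numqN denqN abszN. Qed.

Lemma rat_padic_absV x : abs x^-1 = (abs x)^-1.
Proof.
have [->|x0] := eqVneq x 0; first by rewrite invr0 rat_padic_abs0 ?invr0.
have ax0 : abs x != 0 by rewrite gt_eqF ?rat_padic_abs_gt0.
by apply: (mulfI ax0); rewrite -rat_padic_absM !divff// rat_padic_abs1.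
Qed.

Lemma rat_padic_absD x y : abs (x + y) <= Num.max (abs x) (abs y).
Proof.
have [->|x0] := eqVneq x 0; first by rewrite add0r le_max lexx orbT.
have [->|y0] := eqVneq y 0; first by rewrite addr0 le_max lexx.
have [->|xy0] := eqVneq (x + y) 0.
  by rewrite rat_padic_abs0 le_max rat_padic_abs_ge0.
pose d := denq x * denq y.
have d0 : d != 0 by rewrite mulf_neq0 ?denq_eq0.
pose a := numq x * denq y; pose b := numq y * denq x.
have xE : x = a%:Q / d%:Q.
  rewrite /a /d !intrM -mulf_div divff ?mulr1 ?divq_num_den//.
  by rewrite intr_eq0 denq_eq0.
have yE : y = b%:Q / d%:Q.
  rewrite /b /d [denq x * _]mulrC !intrM -mulf_div divff ?mulr1 ?divq_num_den//.
  by rewrite intr_eq0 denq_eq0.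
have xyE : x + y = (a + b)%:Q / d%:Q by rewrite intrD mulrDl -xE -yE.
have num0 (c : int) z : z != 0 -> z = c%:Q / d%:Q -> c != 0.
  by move=> z0 zE; apply: contraNneq z0 => c0; rewrite zE c0 mul0r.
have a0 := num0 _ _ x0 xE; have b0 := num0 _ _ y0 yE.
have ab0 := num0 _ _ xy0 xyE.
rewrite xyE; rewrite xE yE !rat_padic_absE//.
have: (minn (logn p `|a|) (logn p `|b|) <= logn p `|(a + b)%R|)%N.
  set m := minn _ _; rewrite -pfactor_dvdn ?absz_gt0//.
  have dv (c : int) : c != 0 -> (m <= logn p `|c|)%N -> (Posz (p ^ m) %| c)%Z.
    by move=> c0 ml; rewrite dvdzE /= pfactor_dvdn ?absz_gt0.
  have := rpredD (dv _ a0 (geq_minl _ _)) (dv _ b0 (geq_minr _ _)).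
  by rewrite dvdzE.
rewrite geq_min le_max => /orP[] h; apply/orP; [left|right];
  by apply: ler_weXz2l => //; lia.
Qed.

Lemma rat_padic_absB x y : abs (x - y) <= Num.max (abs x) (abs y).
Proof. by rewrite -(rat_padic_absN y) rat_padic_absD. Qed.

Lemma rat_padic_abs_eq x y : abs (x - y) < abs y -> abs x = abs y.
Proof.
move=> h; apply/eqP; rewrite eq_le; apply/andP; split.
  by have := rat_padic_absD (x - y) y; rewrite subrK (max_idPr (ltW h)).
have := rat_padic_absB x (x - y); rewrite subKr le_max => /orP[//|].
by rewrite leNgt h.
Qed.

End RatPadicAbs.

Definition rat_padic_cauchy (p : nat) (u : nat -> rat) : Prop :=
  forall e : rat, 0 < e -> exists N, forall m n, (N <= m)%N -> (N <= n)%N ->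
    rat_padic_abs p (u m - u n) < e.

Definition rat_padic_null (p : nat) (u : nat -> rat) : Prop :=
  forall e : rat, 0 < e -> exists N, forall n, (N <= n)%N ->
    rat_padic_abs p (u n) < e.

Section CauchyRing.
Variables (p : nat) (hp : prime p).
Local Notation abs := (rat_padic_abs p).

Definition padic_cauchyb of prime p : {pred nat -> rat} :=
  fun u => `[< rat_padic_cauchy p u >].

Lemma padic_cauchy_bounded u : rat_padic_cauchy p u ->
  exists2 B : rat, 0 < B & exists N, forall n, (N <= n)%N -> abs (u n) <= B.
Proof.
move=> /(_ 1 ltr01)[N uN]; exists (Num.max 1 (abs (u N))).
  by rewrite lt_max ltr01.
exists N => n Nn; rewrite -(subrK (u N) (u n)).
apply: le_trans (rat_padic_absD hp _ _) _.
by rewrite ge_max !le_max lexx orbT andbT (ltW (uN _ _ Nn _)).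
Qed.

Lemma padic_nullM u v : rat_padic_cauchy p u -> rat_padic_null p v ->
  rat_padic_null p (fun n => u n * v n).
Proof.
move=> /padic_cauchy_bounded[B B0 [N uB]] v0 e e0.
have [M vM] := v0 (e / B) (divr_gt0 e0 B0).
exists (maxn N M) => n; rewrite geq_max => /andP[Nn Mn].
rewrite rat_padic_absM//; have := vM _ Mn; rewrite ltr_pdivlMr// mulrC.
by apply: le_lt_trans; rewrite ler_wpM2r ?rat_padic_abs_ge0 ?uB.
Qed.

Lemma padic_cauchyb_subring : subring_closed (padic_cauchyb hp).
Proof.
split.
- apply/asboolP => e e0; exists 0%N => m n _ _.
  by rewrite subrr rat_padic_abs0.
- move=> u v /asboolP cu /asboolP cv; apply/asboolP => e e0.
  have [N uN] := cu _ e0; have [M vM] := cv _ e0.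
  exists (maxn N M) => m n; rewrite !geq_max => /andP[Nm Mm] /andP[Nn Mn].
  have -> : (u - v) m - (u - v) n = (u m - u n) - (v m - v n).
    by rewrite !fctE /=; ring.
  apply: le_lt_trans (rat_padic_absB hp _ _) _.
  by rewrite gt_max uN// vM.
- move=> u v /asboolP cu /asboolP cv; apply/asboolP => e e0.
  have [A A0 [K uA]] := padic_cauchy_bounded cu.
  have [B B0 [L vB]] := padic_cauchy_bounded cv.
  have [N uN] := cu _ (divr_gt0 e0 B0); have [M vM] := cv _ (divr_gt0 e0 A0).
  exists (maxn (maxn K L) (maxn N M)) => m n; rewrite !geq_max.
  move=> /andP[/andP[Km Lm] /andP[Nm Mm]] /andP[/andP[Kn Ln] /andP[Nn Mn]].
  have -> : (u * v) m - (u * v) n = u m * (v m - v n) + (u m - u n) * v n.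
    by rewrite !fctE /=; ring.
  apply: le_lt_trans (rat_padic_absD hp _ _) _.
  rewrite gt_max !rat_padic_absM//; apply/andP; split.
    have := vM _ _ Mm Mn; rewrite ltr_pdivlMr// mulrC; apply: le_lt_trans.
    by rewrite ler_wpM2r ?rat_padic_abs_ge0 ?uA.
  have := uN _ _ Nm Nn; rewrite ltr_pdivlMr//; apply: le_lt_trans.
  by rewrite ler_wpM2l ?rat_padic_abs_ge0 ?vB.
Qed.

HB.instance Definition _ :=
  GRing.isSubringClosed.Build _ (padic_cauchyb hp) padic_cauchyb_subring.

Record padic_cauchy_seq := PadicCauchySeq {
  padic_seq :> nat -> rat; _ : padic_seq \in padic_cauchyb hp }.

HB.instance Definition _ := [isSub for padic_seq].
HB.instance Definition _ := [Choice of padic_cauchy_seq by <:].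
HB.instance Definition _ :=
  [SubChoice_isSubComNzRing of padic_cauchy_seq by <:].

Lemma padic_seqP (u : padic_cauchy_seq) : rat_padic_cauchy p u.
Proof. by case: u => u /= /asboolP. Qed.

Definition padic_nullb : {pred padic_cauchy_seq} :=
  fun u => `[< rat_padic_null p u >].

Lemma padic_nullb_ideal : idealr_closed padic_nullb.
Proof.
split.
- by apply/asboolP => e e0; exists 0%N => n _; rewrite rat_padic_abs0.
- apply/negP => /asboolP/(_ 1 ltr01)[N /(_ _ (leqnn N))].
  by rewrite rat_padic_abs1// ltxx.
- move=> a u v /asboolP u0 /asboolP v0; apply/asboolP => e e0.
  have [N uN] := padic_nullM (padic_seqP a) u0 e0; have [M vM] := v0 _ e0.
  exists (maxn N M) => n; rewrite geq_max => /andP[Nn Mn].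
  apply: le_lt_trans (rat_padic_absD hp _ _) _.
  by rewrite gt_max (uN _ Nn) (vM _ Mn).
Qed.

HB.instance Definition _ :=
  isIdealr.Build padic_cauchy_seq padic_nullb padic_nullb_ideal.

End CauchyRing.

Definition Qp (p : nat) (hp : prime p) : Type :=
  {ideal_quot @padic_nullb p hp}.

HB.instance Definition _ p (hp : prime p) := GRing.ComNzRing.on (Qp hp).

Section QpField.
Variables (p : nat) (hp : prime p).
Local Notation abs := (rat_padic_abs p).

Lemma padic_cauchy_nonnull u : rat_padic_cauchy p u -> ~ rat_padic_null p u ->
  exists2 c, 0 < c & exists N, forall n, (N <= n)%N -> abs (u n) = c.
Proof.
move=> cu /existsNP[e /not_implyP[e0 /forallNP nu]].
have [N uN] := cu _ e0.
have /existsNP[n0 /not_implyP[Nn0 /negP]] := nu N; rewrite -leNgt => le.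
exists (abs (u n0)); first exact: lt_le_trans e0 le.
exists N => n Nn; apply: rat_padic_abs_eq => //.
by apply: lt_le_trans (uN _ _ _ _) le.
Qed.

Definition Qp_inv (x : Qp hp) : Qp hp := xget 0 [set y | y * x = 1]%classic.

Lemma Qp_mulVf x : x != 0 -> Qp_inv x * x = 1.
Proof.
move=> x0; rewrite /Qp_inv; case: xgetP => [y _ //|/(_ _)].
suff [y yx] : exists y, y * x = 1 by move=> /(_ y).
pose u := repr x.
have nu : ~ rat_padic_null p u.
  apply: contraNnot x0 => nu; rewrite -[x]reprK [_ == _]piE Quotient.equivE subr0.
  exact/asboolP.
have [c c0 [N uN]] := padic_cauchy_nonnull (@padic_seqP _ _ u) nu.
have cv : (fun n => (u n)^-1) \in padic_cauchyb hp.
  apply/asboolP => e e0.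
  have [M uM] := padic_seqP u (mulr_gt0 e0 (mulr_gt0 c0 c0)).
  exists (maxn N M) => m n; rewrite !geq_max => /andP[Nm Mm] /andP[Nn Mn].
  have un0 k : (N <= k)%N -> u k != 0.
    by move=> /uN uk; apply: contraTneq c0 => uk0; rewrite -uk uk0 rat_padic_abs0 ltxx.
  have -> : (u m)^-1 - (u n)^-1 = (u n - u m) * ((u m) * (u n))^-1.
    by rewrite invfM mulrBl mulrCA divff ?un0// mulr1 mulrA divff ?un0// mul1r.
  rewrite rat_padic_absM// rat_padic_absV// rat_padic_absM// !uN//.
  by rewrite ltr_pdivrMr ?mulr_gt0// uM.
exists (\pi_(Qp hp)%qT (PadicCauchySeq cv)); rewrite -[x]reprK.
apply/eqP; rewrite [_ == _]piE Quotient.equivE; apply/asboolP => e e0.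
exists N => n /uN un; rewrite -[X in X < _]/(abs ((u n)^-1 * u n - 1)).
rewrite mulVf ?subrr ?rat_padic_abs0//.
by apply: contraTneq c0 => uk0; rewrite -un uk0 rat_padic_abs0 ltxx.
Qed.

Lemma Qp_inv0 : Qp_inv 0 = 0.
Proof.
rewrite /Qp_inv; case: xgetP => // y _ /= /eqP.
by rewrite mulr0 eq_sym oner_eq0.
Qed.

HB.instance Definition _ :=
  GRing.ComNzRing_isField.Build (Qp hp) Qp_mulVf Qp_inv0.

End QpField.

Section PadicAnalysis.
Variables (p : nat) (hp : prime p).
Implicit Types x l : Qp hp.

(* Along a representative of x != 0 the sequence of absolute values is
   eventually constant; for x = 0 no nonzero r qualifies. *)
Definition Qp_abs x : rat := xget 0
  [set r | exists N, forall n, (N <= n)%N ->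
             rat_padic_abs p (repr x n) = r]%classic.

Definition Qp_cvg (u : nat -> Qp hp) l : Prop :=
  forall e : rat, 0 < e -> exists N, forall n, (N <= n)%N ->
    Qp_abs (u n - l) < e.

(* The value is 0 where the series diverges. *)
Definition Qp_exp x : Qp hp := xget 0
  [set l | Qp_cvg (fun n => \sum_(i < n) x ^+ i / (i`!)%:R) l]%classic.

Variable R : realType.

Definition exp_radius : R := p%:R `^ (- (p.-1%:R)^-1).

Definition exp_domain x : Prop := ratr (Qp_abs x) < exp_radius.

Definition calE x : Prop :=
  Qp_abs x = 1 /\ ratr (Qp_abs (x - 1)) < exp_radius.

End PadicAnalysis.

Record cayley_tree (k : nat) := CayleyTree {
  vertex :> choiceType;
  edge : rel vertex;
  edge_sym : symmetric edge;
  edge_irr : irreflexive edge;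
  edge_degree : forall x, ([set y | edge x y]%classic #= `I_k.+1)%card;
  edge_connected : forall x y, exists2 s, path edge x s & last x s = y;
  edge_acyclic : forall c, ucycle edge c -> (size c <= 2)%N }.

Section Tree.
Variables (k : nat) (G : cayley_tree k).
Implicit Types x y : G.

Definition walk_length x y : pred nat :=
  fun n => `[< exists s, [/\ path (@edge k G) x s, last x s = y & size s = n] >].

Lemma walk_length_ex x y : exists n, walk_length x y n.
Proof.
have [s xs sy] := edge_connected x y.
by exists (size s); apply/asboolP; exists s.
Qed.

Definition dist x y : nat := ex_minn (walk_length_ex x y).

Lemma distxx x : dist x x = 0%N.
Proof.
rewrite /dist; case: ex_minnP => n _ /(_ 0%N); rewrite leqn0 => h.
by apply/eqP/h/asboolP; exists [::].
Qed.

Lemma dist_next x y n : dist x y = n.+1 ->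
  exists2 z, edge x z & (dist z y <= n)%N.
Proof.
rewrite {1}/dist; case: ex_minnP => m /asboolP[[|z s] [/= xs sy <-]] _ // [mn].
move: xs => /andP[xz zs]; exists z => //; rewrite -mn.
by rewrite /dist; case: ex_minnP => l _; apply; apply/asboolP; exists s.
Qed.

Variable x0 : G.

Lemma ball_finite n : finite_set [set x | (dist x x0 <= n)%N]%classic.
Proof.
elim: n => [|n IHn].
  apply: (sub_finite_set _ (finite_set1 x0)) => x /=.
  rewrite leqn0 /dist; case: ex_minnP => m /asboolP[s [_ sx <-]] _ /nilP s0.
  by rewrite s0 in sx.
apply: (@sub_finite_set _ _ ([set x | (dist x x0 <= n)%N] `|`
    \bigcup_(z in [set x | (dist x x0 <= n)%N]) [set x | edge z x])%classic).
  move=> x /=; rewrite leq_eqVlt => /orP[/eqP/dist_next[z xz zn]|]; last by left.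
  by right; exists z => //=; rewrite edge_sym.
rewrite finite_setU; split=> //; apply: bigcup_finite => // z _.
by exists k.+1; apply: edge_degree.
Qed.

Lemma sphere_finite n : finite_set [set x | dist x x0 = n]%classic.
Proof. by apply: sub_finite_set (ball_finite n) => x /= ->. Qed.

(* V_n and W_n; the sets are finite, so fset_set takes no default value. *)
Definition ball n : {fset G} := fset_set [set x | (dist x x0 <= n)%N]%classic.
Definition sphere n : {fset G} := fset_set [set x | dist x x0 = n]%classic.

Lemma in_ball n x : (x \in ball n) = (dist x x0 <= n)%N.
Proof.
rewrite in_fset_set; last exact: ball_finite.
by apply/idP/idP => [/set_mem//|/mem_set].
Qed.

Lemma in_sphere n x : (x \in sphere n) = (dist x x0 == n).
Proof.
rewrite in_fset_set; last exact: sphere_finite.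
by apply/idP/eqP => [/set_mem//|/mem_set].
Qed.

Lemma root_ball n : x0 \in ball n.
Proof. by rewrite in_ball distxx. Qed.

End Tree.

Section Potts.
Variables (p : nat) (hp : prime p) (R : realType).
Variables (k : nat) (G : cayley_tree k) (x0 : G) (q : nat) (J : Qp hp).

Local Notation config n := {ffun ball x0 n -> 'I_q}.
Local Notation field := (G -> {ffun 'I_q -> Qp hp}).
Implicit Type ht : field.

Definition restrict n (sigma : G -> 'I_q) : config n :=
  [ffun x => sigma (val x)].

(* sigma \/ omega; vertices of V_(n+1) lie in V_n or in W_(n+1), so the value at
   the root is never used as a default. *)
Definition concat n (sigma : config n) (omega : {ffun sphere x0 n.+1 -> 'I_q}) :
    config n.+1 :=
  [ffun x => if insub (val x) is Some y then sigma y
             else if insub (val x) is Some y then omega y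
             else sigma [` root_ball x0 n]%fset].

Definition ball_edges n : {set {set ball x0 n}} :=
  [set e | [exists x, exists y, edge (val x) (val y) && (e == [set x; y])]].

(* For an edge e = {x, y} the summand is delta_{sigma(x) sigma(y)}. *)
Definition hamiltonian n (sigma : config n) : Qp hp :=
  J * \sum_(e in ball_edges n)
        ([forall x in e, forall y in e, sigma x == sigma y] : bool)%:R.

Definition gibbs_weight ht n (sigma : config n) : Qp hp :=
  Qp_exp (hamiltonian sigma
          + \sum_(x : ball x0 n | val x \in sphere x0 n) ht (val x) (sigma x)).

Definition partition_fun ht n : Qp hp :=
  \sum_(sigma : config n) gibbs_weight ht sigma.

Definition gibbs_dist ht n (sigma : config n) : Qp hp :=
  (partition_fun ht n)^-1 * gibbs_weight ht sigma.

Definition compatible ht : Prop :=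
  forall n (sigma : config n),
    \sum_(omega : {ffun sphere x0 n.+1 -> 'I_q}) gibbs_dist ht (concat sigma omega)
    = gibbs_dist ht sigma.

Definition is_cylinder (A : set (G -> 'I_q)) : Prop :=
  exists n (B : {set config n}),
    A = [set sigma | restrict n sigma \in B]%classic.

Definition cylinder := {A : set (G -> 'I_q) | is_cylinder A}.

Definition config_cylinder n (s : config n) : cylinder :=
  exist _ [set sigma | restrict n sigma \in [set s]%SET]%classic
    (ex_intro _ n (ex_intro _ [set s]%SET erefl)).

Definition padic_probability (mu : cylinder -> Qp hp) : Prop :=
  (forall A B C : cylinder, (sval A `&` sval B = set0)%classic ->
     (sval C = sval A `|` sval B)%classic -> mu C = mu A + mu B) /\
  (forall A : cylinder, sval A = setT -> mu A = 1).

Definition gibbs_measure ht (mu : cylinder -> Qp hp) : Prop :=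
  [/\ forall x i, exp_domain R (ht x i),
      forall n, partition_fun ht n != 0,
      compatible ht,
      padic_probability mu
    & forall n (s : config n), mu (config_cylinder s) = gibbs_dist ht s].

(* l is the last spin.  The root, whose vector only enters the one-point
   distribution, has k+1 successors instead of k and is exempted: compatibility
   at the root forces its reduced vector to be (k+1)/k times the others. *)
Definition translation_invariant ht : Prop :=
  forall x y, x != x0 -> y != x0 -> forall i l : 'I_q, l = q.-1 :> nat ->
    ht x i - ht x l = ht y i - ht y l.

Definition TIpGM (mu : cylinder -> Qp hp) : Prop :=
  exists ht, gibbs_measure ht mu /\ translation_invariant ht.

Definition scaled_indicator (h : Qp hp) (M : {set 'I_q}) : {ffun 'I_q -> Qp hp} :=
  [ffun i => h * (i \in M)%:R].

(* mu is the measure mu_{h 1_M}; the root vector is determined by the others up to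
   an additive constant, which does not affect the measure. *)
Definition gibbs_measure_ind (h : Qp hp) (M : {set 'I_q})
    (mu : cylinder -> Qp hp) : Prop :=
  exists ht, gibbs_measure ht mu /\
    forall x, x != x0 -> ht x = scaled_indicator h M.

End Potts.

Definition potts_ratio (F : fieldType) (q m : nat) (theta z : F) : F :=
  ((theta + m%:R - 1) * z + q%:R - m%:R)
  / (m%:R * z + q%:R - m%:R - 1 + theta).

(* Main.v *)
(* In the tree, the edges of a ball correspond to its vertices other
   than the root, so summing out a sphere factorises the weight: compatibility
   says that each vertex weight is, up to a common factor, the product over the
   children.  For a translation-invariant measure with t_i = exp (h_i - h_l) this
   gives t_i = u_i^k and, at the root with its k + 1 children, shows that
   u_i = u_i^(k+1) / u_i^k lies in E_p.  Since u_i - 1 is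
   proportional to u_i^k - 1, two distinct values u_i <> 1 would make a divided
   difference vanish that is congruent to k (k - 1) / 2 modulo p; hence t takes
   at most two values, and complementing the set bounds its size by q / 2.
   Conversely u = exp (h / k), which provides the root vector, and the measures
   are told apart by their masses at the root. *)

From HB Require Import structures.
Require Import Defs.
From mathcomp Require Import all_boot all_order all_algebra finmap.
From mathcomp Require Import mathcomp_extra boolp classical_sets functions.
From mathcomp Require Import cardinality reals exp.
From mathcomp Require Import ring_quotient zify ring lra.

Set Implicit Arguments.
Unset Strict Implicit.
Unset Printing Implicit Defensive.

Import Order.TTheory GRing.Theory Num.Theory.

Local Open Scope ring_scope.

(** * Absolute value and completeness *)

(** The obstacle is that [t_i = u_i^k] with [t_i] in E_p does not place [u_i] in E_p: the field may
    contain nontrivial [k]-th roots of unity, and without [u_i] close to 1 the divided difference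
    need not reduce to [k (k - 1) / 2]. Only the root, whose exponent [k + 1] differs from [k],
    excludes the other roots. The converse meets the same point from the other side. There [u] in
    E_p is a hypothesis, and it makes [h / k] small even if [p] divides [k], which can happen for
    [p = 2]. Sums of [p]-adic exponentials can cancel, so the nonvanishing of the normalizing
    factors is a hypothesis there too. Both directions rest on one estimate,
    [|u^n - 1| = |n| |u - 1|] on E_p: it controls [h / k], and it shows that E_p has no nontrivial
    roots of unity, which separates the measures. *)

Section PadicAbs.
Variables (p : nat) (hp : prime p).
Local Notation abs := (rat_padic_abs p).
Implicit Types x y : Qp hp.

Lemma Qp_pi_eq0 (u : padic_cauchy_seq hp) :
  (\pi_(Qp hp)%qT u == 0) <-> rat_padic_null p u.
Proof.
rewrite -(rmorph0 (\pi_(Qp hp)%qT)) [_ == _]piE Quotient.equivE subr0.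
by split => /asboolP.
Qed.

Lemma Qp_abs0 : Qp_abs (0 : Qp hp) = 0.
Proof.
have n0 : rat_padic_null p (repr (0 : Qp hp)).
  by apply/Qp_pi_eq0; rewrite reprK.
(* If no eventual value exists, [xget] returns its default 0, as wanted; only a nonzero [r] has to
   be refuted. *)
rewrite /Qp_abs; case: xgetP => // r _ [N uN].
apply/eqP; apply/negPn/negP => r0.
have rp : 0 < r.
  by rewrite lt_neqAle eq_sym r0 -(uN N)// rat_padic_abs_ge0.
have [M uM] := n0 _ rp; have := uM (maxn N M) (leq_maxr _ _).
by rewrite uN ?leq_maxl// ltxx.
Qed.

(** Independence of the representative: [repr x] and [u] differ by a null sequence, eventually below
    [r], and from there on the ultrametric inequality makes both absolute values agree. *)
Lemma Qp_abs_pi (u : padic_cauchy_seq hp) r : 0 < r ->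
  (exists N, forall n, (N <= n)%N -> abs (u n) = r) ->
  Qp_abs (\pi_(Qp hp)%qT u) = r.
Proof.
move=> r0 [N uN]; set x := (\pi_(Qp hp)%qT u).
have nu : rat_padic_null p (repr x - u).
  by apply/Qp_pi_eq0; rewrite rmorphB /= reprK subrr.
have [M uM] := nu _ r0.
have ev n : (maxn N M <= n)%N -> abs (repr x n) = r.
  rewrite geq_max => /andP[Nn Mn]; rewrite -(uN _ Nn).
  apply: rat_padic_abs_eq => //; rewrite (uN _ Nn); exact: uM.
rewrite /Qp_abs; apply: xget_unique; first by exists (maxn N M).
move=> s [K sK]; rewrite -(sK (maxn K (maxn N M))) ?leq_maxl//.
by rewrite ev// leq_maxr.
Qed.

Lemma Qp_absP (u : padic_cauchy_seq hp) : let x := \pi_(Qp hp)%qT u in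
  x != 0 -> 0 < Qp_abs x /\ exists N, forall n, (N <= n)%N -> abs (u n) = Qp_abs x.
Proof.
move=> x x0; have nu : ~ rat_padic_null p u by move/Qp_pi_eq0; exact/negP.
have [c c0 cN] := padic_cauchy_nonnull hp (@padic_seqP _ _ u) nu.
by rewrite (Qp_abs_pi c0 cN).
Qed.

Lemma Qp_abs_gt0 x : x != 0 -> 0 < Qp_abs x.
Proof. by rewrite -{1}[x]reprK => /Qp_absP[]; rewrite reprK. Qed.

Lemma Qp_abs_ge0 x : 0 <= Qp_abs x.
Proof. by have [->|/Qp_abs_gt0/ltW//] := eqVneq x 0; rewrite Qp_abs0. Qed.

Lemma Qp_abs_eq0 x : (Qp_abs x == 0) = (x == 0).
Proof.
by have [->|/Qp_abs_gt0/gt_eqF//] := eqVneq x 0; rewrite Qp_abs0 eqxx.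
Qed.

Lemma Qp_absM x y : Qp_abs (x * y) = Qp_abs x * Qp_abs y.
Proof.
have [->|x0] := eqVneq x 0; first by rewrite mul0r Qp_abs0 mul0r.
have [->|y0] := eqVneq y 0; first by rewrite mulr0 Qp_abs0 mulr0.
move: x0 y0; rewrite -[x]reprK -[y]reprK => /Qp_absP[x0 [N uN]] /Qp_absP[y0 [M vM]].
rewrite -rmorphM; apply: Qp_abs_pi; first exact: mulr_gt0.
exists (maxn N M) => n; rewrite geq_max => /andP[Nn Mn].
by rewrite -(uN _ Nn) -(vM _ Mn) -rat_padic_absM.
Qed.

Lemma Qp_absD x y : Qp_abs (x + y) <= Num.max (Qp_abs x) (Qp_abs y).
Proof.
have [->|x0] := eqVneq x 0; first by rewrite add0r le_max lexx orbT.
have [->|y0] := eqVneq y 0; first by rewrite addr0 le_max lexx.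
have [->|xy0] := eqVneq (x + y) 0; first by rewrite Qp_abs0 le_max Qp_abs_ge0.
move: x0 y0 xy0; rewrite -[x]reprK -[y]reprK -rmorphD.
move=> /Qp_absP[x0 [N uN]] /Qp_absP[y0 [M vM]] /Qp_absP[_ [K wK]].
set n := maxn N (maxn M K).
rewrite -(uN n) ?leq_maxl// -(vM n) ?(leq_trans (leq_maxl M K)) ?leq_maxr//.
rewrite -(wK n) ?(leq_trans (leq_maxr M K)) ?leq_maxr//.
exact: rat_padic_absD.
Qed.

Lemma const_cauchy (r : rat) : (fun=> r) \in padic_cauchyb hp.
Proof.
by apply/asboolP => e e0; exists 0%N => m n _ _; rewrite subrr rat_padic_abs0.
Qed.

Definition Qp_of_rat (r : rat) : Qp hp :=
  \pi_(Qp hp)%qT (PadicCauchySeq (const_cauchy r)).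

Lemma Qp_abs_of_rat r : Qp_abs (Qp_of_rat r) = abs r.
Proof.
have [->|r0] := eqVneq r 0.
  rewrite rat_padic_abs0; apply/eqP; rewrite Qp_abs_eq0; apply/Qp_pi_eq0.
  by move=> e e0; exists 0%N => n _; rewrite rat_padic_abs0.
by apply: Qp_abs_pi; [exact: rat_padic_abs_gt0|exists 0%N].
Qed.

Lemma Qp_of_nat (n : nat) : Qp_of_rat n%:R = n%:R.
Proof.
rewrite -(rmorph_nat (\pi_(Qp hp)%qT)); congr (\pi_(Qp hp)%qT _).
apply: val_inj; rewrite -[RHS]/(val (n%:R : padic_cauchy_seq hp)).
rewrite rmorph_nat; apply/funext => i /=.
by elim: n => // n IHn; rewrite -natr1 IHn -[in RHS]natr1.
Qed.

Lemma Qp_of_ratB r s : Qp_of_rat r - Qp_of_rat s = Qp_of_rat (r - s).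
Proof. by rewrite /Qp_of_rat -rmorphB; congr (\pi_(Qp hp)%qT _); apply: val_inj. Qed.

Lemma Qp_abs_nat n : Qp_abs (n%:R : Qp hp) = if n == 0%N then 0 else p%:R ^- logn p n.
Proof.
rewrite -Qp_of_nat Qp_abs_of_rat; case: eqVneq => [->|n0]; first exact: rat_padic_abs0.
have -> : n%:R = (n : int)%:Q / (1 : int)%:Q by rewrite divr1.
by rewrite rat_padic_absE// logn1 sub0r absz_nat exprnN.
Qed.

Lemma Qp_abs1 : Qp_abs (1 : Qp hp) = 1.
Proof. by rewrite (Qp_abs_nat 1) /= logn1 expr0 invr1. Qed.

Lemma Qp_absN x : Qp_abs (- x) = Qp_abs x.
Proof.
suff a1 : Qp_abs (-1 : Qp hp) = 1 by rewrite -mulN1r Qp_absM a1 mul1r.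
have : Qp_abs (-1 : Qp hp) ^+ 2 == 1 by rewrite expr2 -Qp_absM mulrNN mulr1 Qp_abs1.
rewrite sqrf_eq1 => /orP[/eqP//|/eqP h].
by have := Qp_abs_ge0 (-1); rewrite h.
Qed.

Lemma Qp_dense x e : 0 < e -> exists r, Qp_abs (x - Qp_of_rat r) < e.
Proof.
move=> e0; have [N uN] := padic_seqP (repr x) e0.
exists (repr x N); have [->|] := eqVneq (x - Qp_of_rat (repr x N)) 0.
  by rewrite Qp_abs0.
rewrite -[x in x - _]reprK /Qp_of_rat -rmorphB => /Qp_absP[_ [M vM]].
by rewrite -(vM (maxn N M)) ?leq_maxr//; apply: uN => //; rewrite leq_maxl.
Qed.

(** Replacing each [u n] by a rational within [1/(n+1)] of it gives a Cauchy sequence of rationals,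
    whose class is the limit. *)
Lemma Qp_complete (u : nat -> Qp hp) :
  (forall e, 0 < e -> exists N, forall m n, (N <= m)%N -> (N <= n)%N ->
     Qp_abs (u m - u n) < e) ->
  exists l, Qp_cvg u l.
Proof.
move=> cu; have inv0 n : 0 < (n.+1%:R)^-1 :> rat by rewrite invr_gt0 ltr0n.
have arch (e : rat) : 0 < e -> exists N, forall n, (N <= n)%N -> (n.+1%:R)^-1 < e.
  move=> e0; exists (Num.bound e^-1) => n Nn.
  rewrite invf_plt ?posrE ?ltr0n//; apply: (@lt_le_trans _ _ (Num.bound e^-1)%:R).
    by rewrite archi_boundP// invr_ge0 ltW.
  by rewrite ler_nat ltnW.
have [r ur] := choice (fun n => Qp_dense (u n) (inv0 n)).
have cr : r \in padic_cauchyb hp.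
  apply/asboolP => e e0; have [N uN] := cu _ e0; have [M aM] := arch _ e0.
  exists (maxn N M) => m n; rewrite !geq_max => /andP[Nm Mm] /andP[Nn Mn].
  rewrite -Qp_abs_of_rat -Qp_of_ratB.
  have -> : Qp_of_rat (r m) - Qp_of_rat (r n) =
     (u n - Qp_of_rat (r n)) + ((u m - u n) + - (u m - Qp_of_rat (r m))).
     by ring.
  apply: le_lt_trans (Qp_absD _ _) _; rewrite gt_max (lt_trans (ur n))/= ?aM//.
  apply: le_lt_trans (Qp_absD _ _) _; rewrite gt_max uN//=.
  by rewrite Qp_absN (lt_trans (ur m))// aM.
exists (\pi_(Qp hp)%qT (PadicCauchySeq cr)) => e e0; set l := \pi_(Qp hp)%qT _.
have [N rN] := (asboolP _ cr) _ e0; have [M aM] := arch _ e0.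
exists (maxn N M) => n; rewrite geq_max => /andP[Nn Mn].
rewrite -(subrK (Qp_of_rat (r n)) (u n)) -addrA.
apply: le_lt_trans (Qp_absD _ _) _; rewrite gt_max (lt_trans (ur n))/= ?aM//.
have [->|] := eqVneq (Qp_of_rat (r n) - l) 0; first by rewrite Qp_abs0.
rewrite /Qp_of_rat /l -rmorphB => /Qp_absP[_ [K wK]].
by rewrite -(wK (maxn N K)) ?leq_maxr//; apply: rN => //; rewrite leq_maxl.
Qed.

End PadicAbs.

(** * The exponential on its disc of convergence *)

(** Bernoulli's inequality in the form [c^n (1 + n (1 - c)) <= 1], followed by the archimedean
    property of [rat]. *)
Lemma geometric_lt (c e : rat) : 0 <= c < 1 -> 0 < e ->
  exists N, forall n, (N <= n)%N -> c ^+ n < e.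
Proof.
move=> /andP[c0 c1] e0; have d0 : 0 < 1 - c by rewrite subr_gt0.
have bern n : c ^+ n * (1 + n%:R * (1 - c)) <= 1.
  elim: n => [|n IHn]; first by rewrite expr0 mul0r addr0 mul1r.
  apply: le_trans IHn; rewrite exprS mulrAC mulrC ler_wpM2l ?exprn_ge0//.
  rewrite -subr_ge0 -natr1.
  rewrite [leRHS](_ : _ = (1 - c) ^+ 2 * (n%:R + 1)); last by ring.
  by rewrite mulr_ge0 ?sqr_ge0// addr_ge0.
have i0 : 0 <= (e * (1 - c))^-1 by rewrite invr_ge0 mulr_ge0 ?ltW.
exists (Num.bound (e * (1 - c))^-1) => n Nn.
have h : 1 < n%:R * (e * (1 - c)).
  rewrite -ltr_pdivrMr ?mulr_gt0// mul1r.
  by apply: lt_le_trans (archi_boundP i0) _; rewrite ler_nat.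
have n1 : 0 < 1 + n%:R * (1 - c) by rewrite ltr_wpDr// mulr_ge0// ltW.
move: (bern n); rewrite -ler_pdivlMr// => /le_lt_trans; apply.
rewrite ltr_pdivrMr// mulrDr mulr1 [e * _]mulrCA; lra.
Qed.

(** Legendre's formula. Its partial sums are carried along with the remaining quotient by [p ^ K],
    counted as at least 1; this 1 is the gain over the cruder bound [n]. *)
Lemma logn_fact_le p n : prime p -> (p.-1 * logn p n`! <= n.-1)%N.
Proof.
move=> hp; case: n => [|n]; first by rewrite logn1 muln0.
have p1 := prime_gt1 hp.
suff bound K : (p.-1 * (\sum_(1 <= i < K.+1) n.+1 %/ p ^ i)
    + maxn 1 (n.+1 %/ p ^ K) <= n.+1)%N.
  by have := bound n.+1; rewrite logn_fact//=; lia.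
elim: K => [|K IHK]; first by rewrite big_geq// muln0 expn0 divn1; lia.
rewrite big_nat_recr//= mulnDr expnSr divnMA.
have := leq_divM (n.+1 %/ p ^ K) p.
move: IHK; move: (n.+1 %/ p ^ K)%N (\sum_(_ <= _ < _) _)%N => a s.
move: (a %/ p)%N => b.
rewrite -[X in (_ * X <= _)%N](prednK (ltnW p1)) mulnS [(b * _)%N]mulnC.
by case: b => [|b]; lia.
Qed.

(* A sealed copy: proof search diverges when it unfolds equations between values
   of Qp_exp. *)
HB.lock Definition padic_exp (p : nat) (hp : prime p) (x : Qp hp) : Qp hp := Qp_exp x.
Arguments padic_exp {p hp} x.

Lemma padic_expE (p : nat) (hp : prime p) (x : Qp hp) : Qp_exp x = padic_exp x.
Proof. by rewrite padic_exp.unlock. Qed.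

Section PadicExp.
Variables (p : nat) (hp : prime p).
Implicit Types x y z t u v h : Qp hp.

(* Raising to the power p-1 keeps an ultrametric absolute value and turns the
   irrational radius p^(-1/(p-1)) into the rational condition p * nrm x < 1. *)
Definition nrm x : rat := Qp_abs x ^+ p.-1.

Let p1_gt0 : (0 < p.-1)%N. Proof. by have := prime_gt1 hp; lia. Qed.
Let p_gt0 : 0 < p%:R :> rat. Proof. by rewrite ltr0n prime_gt0. Qed.

Lemma nrm_ge0 x : 0 <= nrm x. Proof. by rewrite exprn_ge0 ?Qp_abs_ge0. Qed.

Lemma nrm_eq0 x : (nrm x == 0) = (x == 0).
Proof. by rewrite expf_eq0 p1_gt0 Qp_abs_eq0. Qed.

Lemma nrm_gt0 x : (0 < nrm x) = (x != 0).
Proof. by rewrite lt_neqAle nrm_ge0 andbT eq_sym nrm_eq0. Qed.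

Lemma nrm0 : nrm 0 = 0. Proof. by apply/eqP; rewrite nrm_eq0. Qed.

Lemma nrm1 : nrm 1 = 1. Proof. by rewrite /nrm Qp_abs1 expr1n. Qed.

Lemma nrmN x : nrm (- x) = nrm x. Proof. by rewrite /nrm Qp_absN. Qed.

Lemma nrmM x y : nrm (x * y) = nrm x * nrm y.
Proof. by rewrite /nrm Qp_absM exprMn. Qed.

Lemma nrmX x n : nrm (x ^+ n) = nrm x ^+ n.
Proof. by elim: n => [|n IHn]; rewrite ?expr0 ?nrm1// !exprS nrmM IHn. Qed.

Lemma nrmV x : nrm x^-1 = (nrm x)^-1.
Proof.
have [->|x0] := eqVneq x 0; first by rewrite invr0 nrm0 invr0.
have nx0 : nrm x != 0 by rewrite nrm_eq0.
by apply: (mulfI nx0); rewrite -nrmM !divff// nrm1.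
Qed.

Lemma nrm_lt x (e : rat) : 0 < e -> (nrm x < e ^+ p.-1) = (Qp_abs x < e).
Proof. by move=> e0; rewrite ltr_pXn2r ?nnegrE ?Qp_abs_ge0 ?ltW. Qed.

Lemma nrmD_le x y (B : rat) : nrm x <= B -> nrm y <= B -> nrm (x + y) <= B.
Proof.
move=> xB yB; suff : nrm (x + y) <= Num.max (nrm x) (nrm y).
  by move/le_trans; apply; rewrite ge_max xB.
have := Qp_absD x y; rewrite !le_max => /orP[] h; apply/orP; [left|right].
  by rewrite lerXn2r ?nnegrE ?Qp_abs_ge0.
by rewrite lerXn2r ?nnegrE ?Qp_abs_ge0.
Qed.

Lemma nrmB_le x y (B : rat) : nrm x <= B -> nrm y <= B -> nrm (x - y) <= B.
Proof. by move=> xB yB; rewrite nrmD_le ?nrmN. Qed.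

Lemma nrmD_lt x y (B : rat) : nrm x < B -> nrm y < B -> nrm (x + y) < B.
Proof.
move=> xB yB; apply: le_lt_trans (_ : Num.max (nrm x) (nrm y) < B).
  by rewrite nrmD_le// le_max lexx ?orbT.
by rewrite gt_max xB.
Qed.

Lemma nrm_sum_le (I : Type) (r : seq I) (P : pred I) (F : I -> Qp hp) (B : rat) :
  0 <= B -> (forall i, P i -> nrm (F i) <= B) -> nrm (\sum_(i <- r | P i) F i) <= B.
Proof.
move=> B0 FB; elim/big_rec: _ => [|i x Pi xB]; first by rewrite nrm0.
by rewrite nrmD_le// FB.
Qed.

Lemma nrm_eqB x y : nrm (x - y) < nrm y -> nrm x = nrm y.
Proof.
move=> h; apply/eqP; rewrite eq_le; apply/andP; split.
  by rewrite -[x in leLHS](subrK y x) nrmD_le// ltW.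
rewrite leNgt; apply/negP => xy.
have : nrm y < nrm y by rewrite -{1}(subKr x y) nrmD_lt// nrmN.
by rewrite ltxx.
Qed.

Lemma nrm_nat n : nrm n%:R = if n == 0%N then 0 else p%:R ^- (p.-1 * logn p n).
Proof.
rewrite /nrm Qp_abs_nat; case: ifP => _; first by rewrite expr0n gtn_eqF.
by rewrite exprVn -exprM mulnC.
Qed.

Lemma nrm_nat_le1 n : nrm n%:R <= 1.
Proof.
rewrite nrm_nat; case: ifP => // _.
by rewrite invf_le1 ?exprn_gt0// exprn_ege1// ler1n prime_gt0.
Qed.

Lemma nrm_nat_coprime n : ~~ (p %| n)%N -> nrm n%:R = 1.
Proof.
rewrite nrm_nat; case: eqVneq => [->|n0 pn]; first by rewrite dvdn0.
by rewrite lognE hp lt0n n0 (negbTE pn) muln0 expr0 invr1.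
Qed.

Lemma Qp_natr_neq0 n : (0 < n)%N -> n%:R != 0 :> Qp hp.
Proof.
by rewrite -nrm_gt0 nrm_nat => /gtn_eqF ->; rewrite invr_gt0 exprn_gt0.
Qed.

(** The exponent [p.-1] in [nrm] clears the denominator of the bound [(n-1)/(p-1)] on the valuation
    of [n!]. *)
Lemma nrm_factV n : nrm (n`!%:R)^-1 <= p%:R ^+ n.-1.
Proof.
rewrite nrmV nrm_nat gtn_eqF ?fact_gt0// invrK.
by rewrite ler_weXn2l ?logn_fact_le// ler1n prime_gt0.
Qed.

Lemma nrm_natV_le n : (0 < n)%N -> nrm (n%:R)^-1 <= p%:R ^+ n.-1.
Proof.
(* Since [1/n = (n-1)!/n!] with [(n-1)!] integral, the factorial bound applies. *)
move=> n0; apply: le_trans (nrm_factV n); rewrite !nrmV -{2}(prednK n0) factS.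
rewrite prednK// natrM nrmM invfM ler_peMr ?invr_ge0 ?nrm_ge0//.
by rewrite invf_ge1 ?nrm_nat_le1// nrm_gt0 Qp_natr_neq0 ?fact_gt0.
Qed.

Definition small x : bool := p%:R * nrm x < 1.

Lemma small_nrm_lt1 x : small x -> nrm x < 1.
Proof.
rewrite /small; apply: le_lt_trans; rewrite ler_peMl ?nrm_ge0//.
by rewrite ler1n prime_gt0.
Qed.

Lemma small_le x y : nrm x <= nrm y -> small y -> small x.
Proof. by move=> xy; apply: le_lt_trans; apply: ler_wpM2l => //; exact: ltW. Qed.

Lemma smallE x : small x = (nrm x < p%:R^-1).
Proof. by rewrite /small mulrC -ltr_pdivlMr// mul1r. Qed.

Lemma small0 : small 0. Proof. by rewrite /small nrm0 mulr0. Qed.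

Lemma smallD x y : small x -> small y -> small (x + y).
Proof. by rewrite !smallE; exact: nrmD_lt. Qed.

Lemma smallN x : small (- x) = small x.
Proof. by rewrite !smallE nrmN. Qed.

Lemma smallB x y : small x -> small y -> small (x - y).
Proof. by move=> sx sy; rewrite smallD ?smallN. Qed.

Lemma smallM x y : nrm x <= 1 -> small y -> small (x * y).
Proof. by move=> x1; apply: small_le; rewrite nrmM ler_piMl ?nrm_ge0. Qed.

Lemma small_sum (I : Type) (r : seq I) (P : pred I) (F : I -> Qp hp) :
  (forall i, P i -> small (F i)) -> small (\sum_(i <- r | P i) F i).
Proof. by move=> sF; elim/big_ind: _ => //; [exact: small0|exact: smallD]. Qed.

Local Notation c x := (p%:R * nrm x).

Lemma c_ge0 x : 0 <= c x. Proof. by rewrite mulr_ge0 ?nrm_ge0 ?ltW. Qed.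

Lemma nrm_le_c x : nrm x <= c x.
Proof. by rewrite ler_peMl ?nrm_ge0// ler1n prime_gt0. Qed.

Definition exp_term x i : Qp hp := x ^+ i / (i`!)%:R.
Definition exp_sum x n : Qp hp := \sum_(i < n) exp_term x i.

(** [i!] costs only [p^(i-1)], so one factor [nrm x] is left over beside the powers of [c x];
    [nrm_exp_sub] relies on it. *)
Lemma nrm_exp_term x i : (0 < i)%N -> nrm (exp_term x i) <= nrm x * c x ^+ i.-1.
Proof.
case: i => // i _; rewrite nrmM nrmX exprS -mulrA ler_wpM2l ?nrm_ge0//=.
rewrite exprMn mulrC ler_wpM2r -?nrmX ?nrm_ge0//; exact: (nrm_factV i.+1).
Qed.

Lemma nrm_exp_term_le x i : nrm (exp_term x i) <= c x ^+ i.
Proof.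
case: i => [|i]; first by rewrite /exp_term !expr0 divr1 nrm1.
apply: le_trans (nrm_exp_term _ _) _ => //=.
by rewrite exprS ler_wpM2r ?nrm_le_c// exprn_ge0 ?c_ge0.
Qed.

Lemma exp_sum_tail x n m : small x -> (n <= m)%N ->
  nrm (exp_sum x m - exp_sum x n) <= c x ^+ n.
Proof.
move=> sx nm; rewrite /exp_sum -!(big_mkord xpredT) (big_cat_nat (leq0n n) nm)//=.
rewrite addrAC subrr add0r.
rewrite big_nat nrm_sum_le ?exprn_ge0 ?c_ge0// => i /andP[ni _].
apply: le_trans (nrm_exp_term_le _ _) _.
by rewrite ler_wiXn2l ?c_ge0// ltW.
Qed.

Lemma nrm_exp_sum_le1 x n : small x -> nrm (exp_sum x n) <= 1.
Proof.
move=> sx; have := exp_sum_tail sx (leq0n n).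
by rewrite expr0 {2}/exp_sum big_ord0 subr0.
Qed.

(* The bounds below hold up to an error c ^+ n for every n; this removes it. *)
Lemma nrm_le_geometric x y (B : rat) : small x -> 0 <= B ->
  (forall n, (1 < n)%N -> nrm y <= Num.max (c x ^+ n) B) -> nrm y <= B.
Proof.
move=> sx B0 yB; rewrite leNgt; apply/negP => By.
have [|N cN] := @geometric_lt (c x) _ _ (le_lt_trans B0 By).
  by rewrite c_ge0.
have := yB N.+2 isT; rewrite le_max => /orP[]; last by rewrite leNgt By.
by rewrite leNgt cN// -addn2 leq_addr.
Qed.

Lemma exp_cvg x : small x -> Qp_cvg (exp_sum x) (Qp_exp x).
Proof.
move=> sx; rewrite /Qp_exp; case: xgetP => // /(_ _) ncv.
have [|l lx] := @Qp_complete _ _ (exp_sum x); last by case: (ncv _ lx).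
move=> e e0; have [|N cN] := @geometric_lt (c x) (e ^+ p.-1) _ (exprn_gt0 _ e0).
  by rewrite c_ge0.
exists N; wlog: / forall m n, (N <= m)%N -> (m <= n)%N ->
    Qp_abs (exp_sum x n - exp_sum x m) < e.
  apply=> m n Nm mn; rewrite -nrm_lt//.
  by apply: le_lt_trans (exp_sum_tail _ _) _ => //; apply: cN.
move=> h m n Nm Nn; have [/h mn|nm] := leqP m n.
  by rewrite -Qp_absN opprB mn.
exact: (h _ _ Nn (ltnW nm)).
Qed.

(** Nothing is lost in the limit: otherwise a partial sum close enough to [padic_exp x] would split
    [w] into two terms of norm smaller than [nrm w]. *)
Lemma exp_tail x n : small x -> nrm (padic_exp x - exp_sum x n) <= c x ^+ n.
Proof.
move=> sx; set w := _ - _; have [->|w0] := eqVneq w 0.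
  by rewrite nrm0 exprn_ge0 ?c_ge0.
have [N EN] := exp_cvg sx (Qp_abs_gt0 w0); rewrite padic_expE in EN.
set E := exp_sum x (maxn N n).
have wE : w = - (E - padic_exp x) + (E - exp_sum x n) by rewrite /w; ring.
rewrite leNgt; apply/negP => cw; suff : nrm w < nrm w by rewrite ltxx.
rewrite {1}wE; apply: nrmD_lt.
  by rewrite nrmN nrm_lt ?Qp_abs_gt0// EN// leq_maxl.
by apply: le_lt_trans cw; rewrite exp_sum_tail// leq_maxr.
Qed.

Lemma nrm_exp_le1 x : small x -> nrm (padic_exp x) <= 1.
Proof.
move=> sx; have := exp_tail 0 sx.
by rewrite expr0 /exp_sum big_ord0 subr0.
Qed.


Lemma exp_termD x y n :
  exp_term (x + y) n = \sum_(i < n.+1) exp_term x i * exp_term y (n - i).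
Proof.
rewrite /exp_term addrC exprDn mulr_suml; apply: eq_bigr => i _.
have le : (i <= n)%N by rewrite -ltnS.
rewrite mulf_div -natrM [y ^+ _ * _]mulrC -mulr_natr.
rewrite -!mulrA; congr (_ * (_ * _)).
have f0 m : (m`!)%:R != 0 :> Qp hp by rewrite Qp_natr_neq0 ?fact_gt0.
by rewrite -(bin_fact le) !natrM invfM mulrA divff ?mul1r// Qp_natr_neq0 ?bin_gt0.
Qed.

(** The Cauchy product cut to the triangle of exponents with sum below [n]; [expD] compares it with
    the full square. *)
Lemma exp_sumD x y n :
  exp_sum (x + y) n = \sum_(i < n) exp_term x i * exp_sum y (n - i).
Proof.
elim: n => [|n IHn]; first by rewrite /exp_sum !big_ord0.
rewrite /exp_sum big_ord_recr/= -/(exp_sum _ _) IHn exp_termD.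
rewrite !big_ord_recr/= addrA -big_split/= subnn subSn// subnn; congr (_ + _).
  apply: eq_bigr => i _; rewrite -mulrDr subSn ?(ltnW (ltn_ord i))//.
  by rewrite /exp_sum big_ord_recr.
by rewrite /exp_sum big_ord1.
Qed.

Lemma expD x y : small x -> small y -> padic_exp (x + y) = padic_exp x * padic_exp y.
Proof.
move=> sx sy; wlog xy : x y sx sy / nrm x <= nrm y.
  have [h|/ltW h] := leP (nrm x) (nrm y) => IH; first exact: IH.
  by rewrite addrC mulrC IH.
apply/eqP; rewrite -subr_eq0 -nrm_eq0 eq_le nrm_ge0 andbT.
have cxy : c x <= c y by rewrite ler_wpM2l ?(ltW p_gt0).
apply: (nrm_le_geometric sy) => // n _; rewrite le_max; apply/orP; left.
have sxy := smallD sx sy.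
(* Three truncation errors, and the part of the product of partial sums outside the triangle. Each
   is at most [c y ^+ n], [y] being the argument of larger norm. *)
have split (e a b e' a' b' : Qp hp) : e - a * b =
  (e - e') - (a - a') * b - a' * (b - b') - (a' * b' - e') by ring.
rewrite (split _ _ _ (exp_sum (x + y) n) (exp_sum x n) (exp_sum y n)) {split}.
have cx : c x ^+ n <= c y ^+ n by rewrite lerXn2r ?nnegrE ?c_ge0.
apply: nrmB_le; [apply: nrmB_le; [apply: nrmB_le|]|].
- apply: le_trans (exp_tail _ _) _ => //.
  by rewrite lerXn2r ?nnegrE ?c_ge0// ler_wpM2l ?(ltW p_gt0)// nrmD_le.
- rewrite nrmM; apply: le_trans cx; rewrite -[leRHS]mulr1.
  by rewrite ler_pM ?nrm_ge0 ?exp_tail ?nrm_exp_le1.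
- rewrite nrmM -[leRHS]mul1r.
  by rewrite ler_pM ?nrm_ge0 ?exp_tail ?nrm_exp_sum_le1.
- rewrite exp_sumD {1}/exp_sum mulr_suml -sumrB nrm_sum_le ?exprn_ge0 ?c_ge0//.
  move=> i _; rewrite -mulrBr nrmM -[X in _ <= _ ^+ X](subnKC (ltnW (ltn_ord i))) exprD.
  rewrite ler_pM ?nrm_ge0 ?exp_sum_tail ?leq_subr//.
  by apply: le_trans (nrm_exp_term_le _ _) _; rewrite lerXn2r ?nnegrE ?c_ge0.
Qed.

Lemma exp0 : padic_exp (0 : Qp hp) = 1.
Proof.
apply/eqP; rewrite -subr_eq0 -nrm_eq0 eq_le nrm_ge0 andbT.
have := exp_tail 1 small0; rewrite nrm0 mulr0 expr0n.
by rewrite /exp_sum big_ord1 /exp_term expr0 divr1.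
Qed.

Lemma nrm_exp_sub x : small x -> nrm (padic_exp x - 1 - x) <= c x * nrm x.
Proof.
move=> sx; apply: (nrm_le_geometric sx); rewrite ?mulr_ge0 ?c_ge0 ?nrm_ge0//.
move=> n n1; rewrite -addrA -opprD -(subrK (exp_sum x n) (padic_exp x)) -addrA.
rewrite nrmD_le// le_max ?exp_tail//; apply/orP; right.
rewrite /exp_sum -(big_mkord xpredT) big_ltn ?(ltnW n1)// big_ltn//.
rewrite {1 2}/exp_term expr0 expr1 !divr1 addrA addrC addKr.
rewrite big_nat nrm_sum_le ?mulr_ge0 ?c_ge0 ?nrm_ge0// => i /andP[i1 _].
apply: le_trans (nrm_exp_term _ _) _; first exact: ltnW.
rewrite mulrC ler_wpM2r ?nrm_ge0// -[leRHS]expr1 ler_wiXn2l ?c_ge0 ?ltW//.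
by case: i i1 => // -[].
Qed.

(** The terms of degree at least 2 are smaller than [x] because [c x < 1]; injectivity of the
    exponential follows. *)
Lemma nrm_exp_sub1 x : small x -> nrm (padic_exp x - 1) = nrm x.
Proof.
move=> sx; have [->|x0] := eqVneq x 0; first by rewrite exp0 subrr.
apply: nrm_eqB; apply: le_lt_trans (nrm_exp_sub sx) _.
by rewrite gtr_pMl ?nrm_gt0.
Qed.

Lemma small_exp x : small x -> small (padic_exp x - 1).
Proof. by move=> sx; rewrite smallE nrm_exp_sub1 -?smallE. Qed.

Lemma expN x : small x -> padic_exp (- x) * padic_exp x = 1.
Proof. by move=> sx; rewrite -expD ?smallN// addNr exp0. Qed.

Lemma exp_neq0 x : small x -> padic_exp x != 0.
Proof.
by move=> /expN h; apply: contra_eq_neq h => ->; rewrite mulr0 eq_sym oner_eq0.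
Qed.

Lemma expB x y : small x -> small y -> padic_exp (x - y) = padic_exp x / padic_exp y.
Proof.
move=> sx sy; apply: (mulIf (exp_neq0 sy)); rewrite divfK ?exp_neq0//.
by rewrite -expD ?subrK// smallB.
Qed.

Lemma exp_eq1 x : small x -> (padic_exp x == 1) = (x == 0).
Proof. by move=> sx; rewrite -[LHS]subr_eq0 -[LHS]nrm_eq0 nrm_exp_sub1 ?nrm_eq0. Qed.

Lemma exp_inj x y : small x -> small y -> padic_exp x = padic_exp y -> x = y.
Proof.
move=> sx sy e; apply/eqP; rewrite -subr_eq0 -exp_eq1; last exact: smallB.
by rewrite (expB sx sy) e (divff (exp_neq0 sy)) eqxx.
Qed.

Lemma small_mulrn x n : small x -> small (n%:R * x).
Proof. by move=> sx; rewrite smallM ?nrm_nat_le1. Qed.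

Lemma exp_natmul x n : small x -> padic_exp (n%:R * x) = padic_exp x ^+ n.
Proof.
move=> sx; elim: n => [|n IHn]; first by rewrite mul0r exp0.
by rewrite -natr1 mulrDl mul1r expD ?small_mulrn// IHn exprSr.
Qed.

Lemma small_bool x (b : bool) : small x -> small (x * b%:R).
Proof. by case: b => sx; rewrite ?mulr1 ?mulr0 ?small0. Qed.

Lemma exp_bool x (b : bool) : padic_exp (x * b%:R) = padic_exp x ^+ b.
Proof. by case: b; rewrite ?mulr1 ?mulr0 ?exp0. Qed.

Lemma exp_bigsum (I : Type) (r : seq I) (P : pred I) (F : I -> Qp hp) :
  (forall i, P i -> small (F i)) ->
  padic_exp (\sum_(i <- r | P i) F i) = \prod_(i <- r | P i) padic_exp (F i).
Proof.
move=> sF; suff [] : small (\sum_(i <- r | P i) F i) /\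
  padic_exp (\sum_(i <- r | P i) F i) = \prod_(i <- r | P i) padic_exp (F i) by [].
elim/big_rec2: _ => [|i x y Pi [sy yx]]; first by rewrite small0 exp0.
by rewrite smallD ?sF// expD ?sF// yx.
Qed.

(** Past the linear term [n t] of [(1 + t)^n - 1], the term of degree [i] equals
    [n t C(n-1,i-1) t^(i-1) / i]. The denominator costs at most [p^(i-1)] in [nrm], which the powers
    of the small [t] outweigh, even when [p] divides [n]. *)
Lemma nrm_expn_sub1 u n : small (u - 1) ->
  nrm (u ^+ n - 1) = nrm n%:R * nrm (u - 1).
Proof.
move=> su; have [->|n0] := posnP n; first by rewrite expr0 subrr nrm0 mul0r.
have [->|u1] := eqVneq u 1; first by rewrite expr1n !subrr nrm0 mulr0.
rewrite -nrmM; apply: nrm_eqB; set t := u - 1 in su *.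
have t0 : t != 0 by rewrite subr_eq0.
apply: (@le_lt_trans _ _ (nrm n%:R * nrm t * c t)); last first.
  by rewrite nrmM gtr_pMr// mulr_gt0 ?nrm_gt0// Qp_natr_neq0.
have -> : u ^+ n - 1 - n%:R * t = \sum_(2 <= i < n.+1) t ^+ i *+ 'C(n, i).
  rewrite [in u ^+ n](_ : u = 1 + t); last by rewrite /t addrC subrK.
  rewrite exprDn.
  rewrite -(big_mkord xpredT (fun i => 1 ^+ (n - i) * t ^+ i *+ 'C(n, i))).
  have cancel (a b s : Qp hp) : a + (b + s) - a - b = s by ring.
  rewrite big_ltn ?ltnS// big_ltn ?ltnS// !expr1n !mul1r expr0 expr1 bin0 bin1.
  rewrite mulr1n mulr_natl cancel.
  by apply: eq_bigr => i _; rewrite expr1n mul1r.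
rewrite big_nat nrm_sum_le ?mulr_ge0 ?c_ge0 ?nrm_ge0//.
move=> [|[|i]] // _.
have i0 : i.+2%:R != 0 :> Qp hp by rewrite Qp_natr_neq0.
have -> : t ^+ i.+2 *+ 'C(n, i.+2) =
    n%:R * t * ('C(n.-1, i.+1)%:R * (t ^+ i.+1 / i.+2%:R)).
  have diag : 'C(n, i.+2)%:R * i.+2%:R = n%:R * 'C(n.-1, i.+1)%:R :> Qp hp.
    by rewrite -!natrM mulnC -mul_bin_diag.
  have assoc (F : fieldType) (a b c d e f : F) : e != 0 -> d * e = c * f ->
      a * b * d = c * a * (f * (b / e)).
    by move=> e0 /(canRL (mulfK e0)) ->; field.
  by rewrite -mulr_natr exprS (assoc (Qp hp) t (t ^+ i.+1) n%:R _ _ _ i0 diag).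
rewrite !nrmM ler_wpM2l ?mulr_ge0 ?nrm_ge0//.
apply: (@le_trans _ _ (nrm (t ^+ i.+1) * nrm (i.+2%:R)^-1)).
  by rewrite ler_piMl ?mulr_ge0 ?nrm_ge0 ?nrm_nat_le1.
apply: le_trans (_ : c t ^+ i.+1 <= c t).
  by rewrite exprMn mulrC nrmX ler_wpM2r -?nrmX ?nrm_ge0// nrm_natV_le.
by rewrite -[leRHS]expr1 ler_wiXn2l ?c_ge0 ?ltW.
Qed.

(** As [n] is nonzero in characteristic 0, [nrm_expn_sub1] excludes all nontrivial roots of unity
    from E_p, those of [p]-power order included. *)
Lemma unit_torsion_free u n : (0 < n)%N -> small (u - 1) -> u ^+ n = 1 -> u = 1.
Proof.
move=> n0 su un; have /eqP := nrm_expn_sub1 n su.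
rewrite un subrr nrm0 eq_sym mulf_eq0 !nrm_eq0 subr_eq0 => /orP[|/eqP//].
by rewrite (negbTE (Qp_natr_neq0 n0)).
Qed.

Lemma small_sub1_nrm u : small (u - 1) -> nrm u = 1.
Proof. by move=> su; rewrite -nrm1; apply: nrm_eqB; rewrite nrm1 small_nrm_lt1. Qed.

Lemma small_sub1_neq0 u : small (u - 1) -> u != 0.
Proof. by rewrite -nrm_eq0 => /small_sub1_nrm ->; rewrite oner_eq0. Qed.

Lemma small_sub1M u v : small (u - 1) -> small (v - 1) -> small (u * v - 1).
Proof.
move=> su sv; have -> : u * v - 1 = u * (v - 1) + (u - 1) by ring.
by rewrite smallD// smallM ?small_sub1_nrm.
Qed.

Lemma small_sub1V u : small (u - 1) -> small (u^-1 - 1).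
Proof.
move=> su; have u0 := small_sub1_neq0 su.
have -> : u^-1 - 1 = u^-1 * - (u - 1) by rewrite mulrN mulrBr mulVf// mulr1 opprB.
by rewrite smallM ?smallN// nrmV small_sub1_nrm ?invr1.
Qed.

Lemma small_sub1X u n : small (u - 1) -> small (u ^+ n - 1).
Proof.
move=> su; elim: n => [|n IHn]; first by rewrite expr0 subrr small0.
by rewrite exprS small_sub1M.
Qed.

(** Division by [k] could leave the disc when [p] divides [k]; the root [u] prevents it, as [h / k]
    has the norm of [u - 1]. Then [padic_exp (h / k)] and [u] differ by a [k]-th root of unity in
    E_p, which must be 1. *)
Lemma exp_root u h k : (0 < k)%N -> small (u - 1) -> small h ->
  u ^+ k = padic_exp h -> small (h / k%:R) /\ padic_exp (h / k%:R) = u.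
Proof.
move=> k0 su sh uk; have kn0 := Qp_natr_neq0 k0.
have hk : nrm (h / k%:R) = nrm (u - 1).
  rewrite nrmM nrmV -(nrm_exp_sub1 sh) -uk nrm_expn_sub1// mulrC mulKf//.
  by rewrite nrm_eq0.
have shk : small (h / k%:R) by rewrite smallE hk -smallE.
split=> //; apply/eqP; rewrite -subr_eq0.
have u0 := small_sub1_neq0 su.
suff : padic_exp (h / k%:R) / u = 1 by move/(canRL (divfK u0)) ->; rewrite mul1r subrr.
apply: (@unit_torsion_free _ k) => //.
  by rewrite small_sub1M ?small_exp// small_sub1V.
rewrite expr_div_n -exp_natmul// mulrCA divff// mulr1 uk divff//.
exact: exp_neq0.
Qed.

(** * Comparison with the real radius of convergence *)

Section Radius.
Variable R : realType.

Lemma lt_exp_radius (a : rat) : 0 <= a ->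
  (ratr a < exp_radius p R) = (p%:R * a ^+ p.-1 < 1).
Proof.
move=> a0; rewrite -(@ltr_pXn2r _ p.-1) ?nnegrE ?powR_ge0 ?ler0q//.
rewrite /exp_radius -[ltRHS]powR_mulrn ?powR_ge0// -powRrM mulNr mulVf; last first.
  by rewrite pnatr_eq0 -lt0n.
rewrite powR_inv1 ?ler0n// -rmorphXn/= -[p%:R^-1]mul1r ltr_pdivlMr; last first.
  by rewrite ltr0n prime_gt0.
by rewrite -(ratr_nat R p) -rmorphM/= -(rmorph1 (@ratr R)) ltr_rat mulrC.
Qed.

Lemma exp_domainP x : exp_domain R x <-> small x.
Proof. by rewrite /exp_domain lt_exp_radius ?Qp_abs_ge0. Qed.

Lemma calEP x : calE R x <-> small (x - 1).
Proof.
rewrite /calE lt_exp_radius ?Qp_abs_ge0// -/(nrm _) -/(small _).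
split=> [[]//|sx]; split=> //.
have /eqP := small_sub1_nrm sx; rewrite /nrm pexpr_eq1 ?Qp_abs_ge0//.
by move/eqP.
Qed.

End Radius.

End PadicExp.

(** * Parents in a Cayley tree *)

Section TreeCombinatorics.
Variables (k : nat) (G : cayley_tree k) (x0 : G).
Local Notation level := (fun x : G => dist x x0).
Implicit Types x y z : G.

Lemma dist_le_walk x y s : path (@edge k G) x s -> last x s = y ->
  (dist x y <= size s)%N.
Proof.
by move=> xs sy; rewrite /dist; case: ex_minnP => l _; apply; apply/asboolP; exists s.
Qed.

Lemma dist_walk x y :
  exists s, [/\ path (@edge k G) x s, last x s = y & size s = dist x y].
Proof. by rewrite /dist; case: ex_minnP => l /asboolP. Qed.

Lemma level_eq0 x : (level x == 0%N) = (x == x0).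
Proof.
apply/eqP/eqP => [h|->]; last exact: distxx.
have [s [_ sx]] := dist_walk x x0; rewrite h => /size0nil s0.
by rewrite s0 in sx.
Qed.

Lemma level_edge x y : edge x y -> (level x <= (level y).+1)%N.
Proof.
move=> xy; have [s [ys sy <-]] := dist_walk y x0.
by apply: (@dist_le_walk _ _ (y :: s)) => //=; rewrite xy.
Qed.

(** On the way down to the root every vertex after [x] has level below that of [y], so only [x]
    itself has to be told apart from [y]. *)
Lemma walk_to_root_avoiding x y : (level x <= level y)%N -> x != y ->
  exists s, [/\ path (@edge k G) x s, last x s = x0 & y \notin x :: s].
Proof.
have [n] := ubnP (level x); elim: n x => // n IHn x.
rewrite ltnS => xn xy ne; case E : (level x) => [|m].
  exists [::]; split=> //=; last by rewrite inE eq_sym.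
  by apply/eqP; rewrite -level_eq0 E.
have [z xz zm] := dist_next E.
have zy : (level z < level y)%N by apply: leq_trans xy; rewrite E.
have [||s [zs sz ys]] := IHn z _ (ltnW zy) _.
- by apply: leq_ltn_trans zm _; rewrite -E.
- by apply: contraTneq zy => ->; rewrite ltnn.
by exists (z :: s); split=> //=; [rewrite xz|rewrite inE eq_sym negb_or ne].
Qed.

(* Two such neighbours would be joined by a walk through the root avoiding y, hence
   by a simple path which y closes into a cycle. *)
Lemma lower_neighbour_unique y x1 x2 : edge y x1 -> edge y x2 ->
  (level x1 <= level y)%N -> (level x2 <= level y)%N -> x1 = x2.
Proof.
move=> yx1 yx2 l1 l2.
have ne x : edge y x -> x != y by apply: contraTneq => ->; rewrite edge_irr.
have [s1 [p1 e1 n1]] := walk_to_root_avoiding l1 (ne _ yx1).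
have [s2 [p2 e2 n2]] := walk_to_root_avoiding l2 (ne _ yx2).
(* [belast] drops the root, which already ends [s1]. *)
pose s := s1 ++ rev (belast x2 s2).
have ps : path (@edge k G) x1 s.
  rewrite cat_path p1/= e1 -e2 rev_path.
  by apply: sub_path p2 => a b; rewrite edge_sym.
have es : last x1 s = x2.
  rewrite /s last_cat; case: (s2) e2 => [|b t] /= e2; first by rewrite e1.
  by rewrite rev_cons last_rcons.
have ns : y \notin x1 :: s.
  move: n1; rewrite /s !inE !negb_or mem_cat mem_rev => /andP[-> /= n1].
  rewrite negb_or n1/=; apply: contra n2; exact: mem_belast.
move: es ns; case/shortenP: ps => t pt ut st es ns.
have nt : y \notin x1 :: t.
  apply: contra ns; rewrite !inE => /orP[->//|/st ->]; exact: orbT.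
have cyc : ucycle (@edge k G) (y :: x1 :: t).
  apply/andP; split; last by rewrite cons_uniq nt ut.
  by rewrite /= -cats1 cat_path/= yx1 pt es edge_sym yx2.
(* A cycle has at most two vertices, so [t] is empty and [x1 = x2]. *)
by have := edge_acyclic cyc; case: (t) es.
Qed.

(* The root is its own parent. *)
Definition parent x : G :=
  xget x0 [set z | edge x z /\ (level z < level x)%N]%classic.

Lemma parentP x : x != x0 -> edge x (parent x) /\ (level (parent x)).+1 = level x.
Proof.
rewrite -level_eq0; case E : (level x) => [//|n] _.
have [z xz zn] := dist_next E.
have [xp px] : edge x (parent x) /\ (level (parent x) < level x)%N.
  rewrite /parent.
  apply: (@xgetPex _ x0 [set z | edge x z /\ (level z < level x)%N]%classic).
  by exists z; rewrite /= E.
split=> //; apply/eqP; rewrite -E eqn_leq px/=; exact: level_edge.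
Qed.

(** The weak inequality makes this exclude edges between vertices of equal level as well. *)
Lemma lower_neighbour_parent x y : edge x y -> (level y <= level x)%N ->
  x != x0 /\ y = parent x.
Proof.
move=> xy yx; have xn : x != x0.
  apply: contraTneq xy => xx; move: yx; rewrite xx distxx leqn0 level_eq0.
  by move=> /eqP ->; rewrite edge_irr.
split=> //; have [xp px] := parentP xn.
by apply: (lower_neighbour_unique xy xp) => //; rewrite -px.
Qed.

Lemma sphere_neq_root n x : x \in sphere x0 n.+1 -> x != x0.
Proof. by rewrite in_sphere -level_eq0 => /eqP ->. Qed.

Lemma parent_sphere n x : x \in sphere x0 n.+1 -> parent x \in sphere x0 n.
Proof.
move=> xn; have [_] := parentP (sphere_neq_root xn).
by move: xn; rewrite !in_sphere => /eqP -> [->].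
Qed.

Definition branching n : nat := (k + (n == 0))%N.

(** Each neighbour other than the parent lies one level further out; the root, having no parent
    among its neighbours, keeps all [k + 1]. *)
Lemma count_children n x : x \in sphere x0 n ->
  count (fun y => parent y == x) (sphere x0 n.+1) = branching n.
Proof.
move=> xn; have nbr : finite_set [set y | edge x y]%classic.
  by exists k.+1; apply: edge_degree.
pose N := fset_set [set y | edge x y]%classic.
have inN y : (y \in N) = edge x y.
  by rewrite in_fset_set//; apply/idP/idP => [/set_mem//|/mem_set].
have cN : #|` N| = k.+1 by apply/card_fset_set/edge_degree.
pose C := [fset y in sphere x0 n.+1 | parent y == x]%fset.
have inC y : (y \in C) = (y \in sphere x0 n.+1) && (parent y == x).
  by rewrite !inE.
have -> : count (fun y => parent y == x) (sphere x0 n.+1) = #|` C|.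
  rewrite -size_filter; apply/perm_size/uniq_perm; rewrite ?filter_uniq ?fset_uniq//.
  by move=> y; rewrite mem_filter inC andbC.
have lx : level x = n by apply/eqP; rewrite -in_sphere.
have sub y : y \in C -> edge x y.
  rewrite inC => /andP[yn /eqP <-]; rewrite edge_sym.
  by have [] := parentP (sphere_neq_root yn).
have other y : edge x y -> y \notin C -> x != x0 /\ y = parent x.
  move=> xy yC; apply: lower_neighbour_parent => //.
  rewrite leqNgt; apply: contra yC => xley.
  have /eqP yn : level y == n.+1.
    by rewrite eqn_leq -{2}lx xley andbT -lx; apply: level_edge; rewrite edge_sym.
  have [||_ xE] := @lower_neighbour_parent y x _ _; rewrite 1?edge_sym// 1?ltnW//.
  by rewrite inC in_sphere yn -xE !eqxx.
case: n => [|n] in xn C inC lx sub other *.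
  have xx : x = x0 by apply/eqP; rewrite -level_eq0 lx.
  rewrite /branching eqxx addn1 -cN; congr #|` _|; apply/fsetP => y.
  rewrite inN; apply/idP/idP => [/sub//|xy].
  by apply/negPn/negP => /(other _ xy)[]; rewrite xx eqxx.
have [xp px] := parentP (sphere_neq_root xn).
have -> : C = (N `\ parent x)%fset.
  apply/fsetP => y; rewrite !in_fsetD1 inN; apply/idP/andP => [yC|[yp xy]].
    split; last exact: sub.
    move: yC; rewrite inC in_sphere => /andP[+ _]; apply: contraTneq => ->.
    by rewrite lx in px; lia.
  by apply/negPn/negP => /(other _ xy)[_ yE]; rewrite yE eqxx in yp.
by have := cardfsD1 (parent x) N; rewrite inN xp cN /branching/= addn0; lia.
Qed.

Lemma prod_parent (F : comNzRingType) (g : G -> F) n :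
  \prod_(y <- sphere x0 n.+1) g (parent y) =
  \prod_(x <- sphere x0 n) g x ^+ branching n.
Proof.
rewrite (eq_big_seq (fun y => \prod_(x <- sphere x0 n | parent y == x) g x)) /=.
  rewrite (exchange_big_dep xpredT)//=; apply: eq_big_seq => x xn.
  by rewrite big_const_seq count_children// iter_mulr_1.
move=> y yn; under eq_bigl do rewrite eq_sym.
by rewrite -big_filter filter_pred1_uniq ?fset_uniq ?parent_sphere// big_seq1.
Qed.

Lemma parent_ball n x : x \in ball x0 n -> parent x \in ball x0 n.
Proof.
have [->|xx] := eqVneq x x0; last first.
  by rewrite !in_ball; have [_ <-] := parentP xx; apply: ltnW.
rewrite /parent; case: xgetP => [y _ []|_ //].
by rewrite distxx.
Qed.

Definition ball_parent n (y : ball x0 n) : ball x0 n := [` parent_ball (valP y)]%fset.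

Lemma ball_edgesE n :
  ball_edges x0 n = [set [set ball_parent y; y] | y in [pred y | val y != x0]].
Proof.
have bpE (y z : ball x0 n) : val z = parent (val y) -> z = @ball_parent n y.
  by move=> zE; apply: val_inj.
apply/setP => e; rewrite inE; apply/existsP/imsetP => [[x /existsP[y]]|[y]].
  move=> /andP[xy /eqP ->]; have [xley|/ltnW ylex] := leqP (level (val x)) (level (val y)).
    have [|yn xE] := lower_neighbour_parent _ xley; first by rewrite edge_sym.
    by exists y => //; rewrite -(bpE _ _ xE).
  have [xn yE] := lower_neighbour_parent xy ylex.
  by exists x => //; rewrite -(bpE _ _ yE) finset.setUC.
rewrite inE => yn ->; exists (ball_parent y); apply/existsP; exists y.
by rewrite eqxx andbT/= edge_sym; have [] := parentP yn.
Qed.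

Lemma ball_edge_inj n : {in [pred y : ball x0 n | val y != x0] &,
  injective (fun y : ball x0 n => [set ball_parent y; y])}.
Proof.
move=> y z; rewrite !inE => yn zn e.
have [_ yp] := parentP yn; have [_ zp] := parentP zn.
have : y \in [set ball_parent z; z] by rewrite -e !inE eqxx orbT.
rewrite !inE => /orP[/eqP yz|/eqP//].
have : z \in [set ball_parent y; y] by rewrite e !inE eqxx orbT.
rewrite !inE => /orP[/eqP zy|/eqP//].
(* In the remaining case [y] and [z] are parents of each other, so each level would exceed the
   other. *)
have /= e1 := congr1 (fun y : ball x0 n => level (val y)) yz.
have /= e2 := congr1 (fun y : ball x0 n => level (val y)) zy.
by move: yp zp; rewrite -e1 -e2 => <- /eqP; rewrite gtn_eqF // ltnW.
Qed.

Lemma sum_ball_edges (V : nmodType) n (g : {set ball x0 n} -> V) :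
  \sum_(e in ball_edges x0 n) g e =
  \sum_(y : ball x0 n | val y != x0) g [set ball_parent y; y].
Proof. by rewrite ball_edgesE big_imset//; exact: ball_edge_inj. Qed.

Lemma perm_ballS n : perm_eq (ball x0 n.+1) (ball x0 n ++ sphere x0 n.+1).
Proof.
apply: uniq_perm; rewrite ?fset_uniq// ?cat_uniq ?fset_uniq/= ?andbT.
  by apply/hasPn => x; rewrite in_sphere in_ball -ltnNge => /eqP ->.
by move=> x; rewrite mem_cat !in_ball in_sphere leq_eqVlt orbC.
Qed.

End TreeCombinatorics.

(** * Compatibility of Gibbs distributions *)

Section GibbsWeights.
Variables (p : nat) (hp : prime p).
Variables (k : nat) (G : cayley_tree k) (x0 : G) (q : nat) (J : Qp hp).
Hypothesis sJ : small J.

Local Notation config n := {ffun ball x0 n -> 'I_q}.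
Local Notation boundary n := {ffun sphere x0 n -> 'I_q}.
Local Notation field := (G -> {ffun 'I_q -> Qp hp}).
Local Notation restrict n := (@Defs.restrict k G x0 q n).
Local Notation theta := (padic_exp J).
Implicit Types (ht : field) (tau : G -> 'I_q).

Lemma sphere_ball n x : x \in sphere x0 n -> x \in ball x0 n.
Proof. by rewrite in_sphere in_ball => /eqP ->. Qed.

Lemma sphereS_ballN n x : x \in sphere x0 n.+1 -> x \in ball x0 n = false.
Proof. by rewrite in_sphere in_ball => /eqP ->; rewrite ltnn. Qed.

(** Configurations are treated as restrictions of a global [tau], so that sums and products run over
    vertices of [G] and not over the dependent types of the balls. *)
Lemma hamiltonian_restrict n tau : hamiltonian J (restrict n tau) =
  J * \sum_(y <- ball x0 n | y != x0) (tau (parent x0 y) == tau y)%:R.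
Proof.
rewrite /hamiltonian sum_ball_edges big_seq_fsetE; congr (_ * _).
apply: eq_bigr => y _; congr (nat_of_bool _)%:R.
apply/forall_inP/eqP => [/(_ (ball_parent y))|e u].
  rewrite !inE eqxx => /(_ isT)/forall_inP/(_ y).
  by rewrite !inE eqxx orbT !ffunE => /(_ isT)/eqP.
rewrite !inE => uy; apply/forall_inP => v; rewrite !inE => vy.
by case/orP: uy => /eqP ->; case/orP: vy => /eqP ->; rewrite !ffunE ?e.
Qed.

Definition interaction n tau : Qp hp :=
  \prod_(y <- ball x0 n | y != x0) theta ^+ (tau (parent x0 y) == tau y).

Definition boundary_weight ht n tau : Qp hp :=
  \prod_(x <- sphere x0 n) padic_exp (ht x (tau x)).

Lemma interaction_neq0 n tau : interaction n tau != 0.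
Proof.
rewrite prodf_seq_neq0; apply/allP => y _; apply/implyP => _.
exact: expf_neq0 (exp_neq0 sJ).
Qed.

Lemma sum_boundary ht n tau :
  \sum_(x : ball x0 n | val x \in sphere x0 n) ht (val x) (restrict n tau x) =
  \sum_(x <- sphere x0 n) ht x (tau x).
Proof.
under eq_bigr do rewrite ffunE.
rewrite -(big_seq_fsetE _ _ (fun x => x \in sphere x0 n) (fun x => ht x (tau x))).
rewrite -big_filter; apply: perm_big; apply: uniq_perm; rewrite ?filter_uniq//.
by move=> x; rewrite mem_filter; apply/andP/idP => [[]//|xn]; rewrite sphere_ball.
Qed.

Lemma gibbs_weight_restrict ht n tau : (forall x i, small (ht x i)) ->
  gibbs_weight J ht (restrict n tau) = interaction n tau * boundary_weight ht n tau.
Proof.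
move=> sh; rewrite /gibbs_weight padic_expE sum_boundary hamiltonian_restrict mulr_sumr.
rewrite expD; last 2 first.
- by apply: small_sum => y _; exact: small_bool.
- exact: small_sum.
rewrite !exp_bigsum//; last by move=> y _; exact: small_bool.
by congr (_ * _); apply: eq_bigr => y _; rewrite exp_bool.
Qed.

Definition graft n tau (w : boundary n) x : 'I_q :=
  if insub x is Some y then w y else tau x.

Lemma graft_sphere n tau (w : boundary n) (x : sphere x0 n) : graft tau w (val x) = w x.
Proof. by rewrite /graft valK. Qed.

Lemma graft_out n tau (w : boundary n) x : x \notin sphere x0 n -> graft tau w x = tau x.
Proof. by move=> xn; rewrite /graft insubN. Qed.

Lemma ball_sphereSN n x : x \in ball x0 n -> x \notin sphere x0 n.+1.
Proof. by apply: contraL => /sphereS_ballN ->. Qed.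

Lemma concat_restrict n tau (w : boundary n.+1) :
  concat (restrict n tau) w = restrict n.+1 (graft tau w).
Proof.
apply/ffunP => x; rewrite !ffunE /graft; case: insubP => [y yn yE|xn].
  by rewrite insubN ?ball_sphereSN// ffunE yE.
have xS : val x \in sphere x0 n.+1.
  have := valP x; rewrite (perm_mem (perm_ballS x0 n)) mem_cat.
  by rewrite (negbTE xn).
by rewrite insubT.
Qed.

Lemma interaction_graft n tau (w : boundary n.+1) :
  interaction n.+1 (graft tau w) =
  interaction n tau *
  \prod_(y <- sphere x0 n.+1) theta ^+ (tau (parent x0 y) == graft tau w y).
Proof.
rewrite /interaction (perm_big _ (perm_ballS x0 n))/= big_cat/=; congr (_ * _).
  rewrite [LHS]big_seq_cond [RHS]big_seq_cond; apply: eq_bigr => y /andP[yn _].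
  by rewrite !graft_out// ball_sphereSN// parent_ball.
rewrite [LHS]big_seq_cond [RHS]big_seq_cond; apply: eq_big => [y|y /andP[yn _]].
  by case: (boolP (y \in _)) => //= /sphere_neq_root.
rewrite (@graft_out _ _ _ (parent x0 y))// ball_sphereSN// sphere_ball//.
exact: parent_sphere.
Qed.

Definition child_sum ht y i : Qp hp :=
  \sum_j theta ^+ (i == j) * padic_exp (ht y j).

Lemma sum_concat ht n tau : (forall x i, small (ht x i)) ->
  \sum_(w : boundary n.+1) gibbs_weight J ht (concat (restrict n tau) w) =
  interaction n tau * \prod_(y <- sphere x0 n.+1) child_sum ht y (tau (parent x0 y)).
Proof.
move=> sh; rewrite big_seq_fsetE/= bigA_distr_bigA mulr_sumr.
apply: eq_bigr => w _; rewrite concat_restrict gibbs_weight_restrict//.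
rewrite interaction_graft -mulrA /boundary_weight; congr (_ * _).
rewrite !big_seq_fsetE -big_split/=; apply: eq_bigr => y _.
by rewrite (graft_sphere tau w y).
Qed.

Lemma sum_configS n (V : nmodType) (f : config n.+1 -> V) :
  \sum_s f s = \sum_(s : config n) \sum_(w : boundary n.+1) f (concat s w).
Proof.
rewrite pair_big/=.
have ballW (x : ball x0 n) : val x \in ball x0 n.+1.
  by have := valP x; rewrite !in_ball => /leqW.
pose split (s : config n.+1) : config n * boundary n.+1 :=
  ([ffun x => s [` ballW x]%fset], [ffun x => s [` sphere_ball (valP x)]%fset]).
rewrite (reindex (fun sw : config n * boundary n.+1 => concat sw.1 sw.2))//.
exists split => [[s w] _|s _].
  congr (_, _); apply/ffunP => x; rewrite !ffunE/=.
    by rewrite valK.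
  by rewrite insubN ?valK// sphereS_ballN// (valP x).
apply/ffunP => x; rewrite !ffunE/=; case: insubP => [y yn yE|xn].
  by rewrite ffunE; congr (s _); apply: val_inj.
have xS : val x \in sphere x0 n.+1.
  have := valP x; rewrite (perm_mem (perm_ballS x0 n)) mem_cat.
  by rewrite (negbTE xn).
by rewrite insubT ffunE; congr (s _); apply: val_inj.
Qed.

Definition extend (i0 : 'I_q) n (s : config n) (x : G) : 'I_q :=
  if insub x is Some y then s y else i0.

Lemma restrict_extend i0 n (s : config n) : restrict n (extend i0 s) = s.
Proof. by apply/ffunP => x; rewrite ffunE /extend valK. Qed.

Section Levels.
Variable i0 : 'I_q.

Lemma partition_funS ht n : partition_fun x0 J ht n.+1 =
  \sum_(s : config n) \sum_(w : boundary n.+1) gibbs_weight J ht (concat s w).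
Proof. exact: sum_configS. Qed.

(** The interaction inside [V_n] is a nonzero factor of both sides and cancels. *)
Lemma compatibleP ht : (forall x i, small (ht x i)) ->
  compatible x0 J ht <-> forall n tau,
    (partition_fun x0 J ht n.+1)^-1 *
      \prod_(y <- sphere x0 n.+1) child_sum ht y (tau (parent x0 y)) =
    (partition_fun x0 J ht n)^-1 * boundary_weight ht n tau.
Proof.
move=> sh; split=> [cp n tau|cp n s].
  have := cp n (restrict n tau); rewrite /gibbs_dist -mulr_sumr sum_concat//.
  rewrite gibbs_weight_restrict// ![_^-1 * (interaction _ _ * _)]mulrCA.
  exact/mulfI/interaction_neq0.
rewrite -(restrict_extend i0 s) /gibbs_dist -mulr_sumr sum_concat//.
by rewrite gibbs_weight_restrict// mulrCA cp mulrCA.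
Qed.

End Levels.

(** Only the term where the child repeats the parent's spin carries [theta], so each child
    contributes a factor depending on the parent's spin alone, and [prod_parent] collects these over
    the children. *)
Lemma child_prod ht (e : G -> Qp hp) (t : 'I_q -> Qp hp) n tau :
  (forall y j, y != x0 -> padic_exp (ht y j) = e y * t j) ->
  \prod_(y <- sphere x0 n.+1) child_sum ht y (tau (parent x0 y)) =
  \prod_(y <- sphere x0 n.+1) e y *
  \prod_(x <- sphere x0 n) (\sum_j t j + (theta - 1) * t (tau x)) ^+ branching k n.
Proof.
move=> hE; rewrite -(prod_parent x0 (fun x => \sum_j t j + (theta - 1) * t (tau x))).
rewrite -big_split/=; apply: eq_big_seq => y yn.
have yx0 := sphere_neq_root yn; rewrite /child_sum.
rewrite (eq_bigr (fun j => e y * (theta ^+ (tau (parent x0 y) == j) * t j))); last first.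
  by move=> j _; rewrite hE// mulrCA.
rewrite -mulr_sumr; congr (_ * _); set i := tau _.
rewrite (bigD1 i)//= [in RHS](bigD1 i)//= eqxx expr1.
rewrite (eq_bigr t) => [|j ji]; last by rewrite eq_sym (negbTE ji) expr0 mul1r.
by ring.
Qed.

(** A change of the vector at the root is thus felt at level 0 only. *)
Lemma gibbs_weight_local ht ht' n (s : config n) :
  (forall x, x \in sphere x0 n -> ht x = ht' x) ->
  gibbs_weight J ht s = gibbs_weight J ht' s.
Proof.
move=> e; rewrite /gibbs_weight; congr (Qp_exp (_ + _)).
by apply: eq_bigr => x /e ->.
Qed.

Lemma partition_fun_local ht ht' n :
  (forall x, x \in sphere x0 n -> ht x = ht' x) ->
  partition_fun x0 J ht n = partition_fun x0 J ht' n.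
Proof. by move=> e; apply: eq_bigr => s _; exact: gibbs_weight_local. Qed.

Lemma gibbs_dist_local ht ht' n (s : config n) :
  (forall x, x \in sphere x0 n -> ht x = ht' x) ->
  gibbs_dist J ht s = gibbs_dist J ht' s.
Proof.
by move=> e; rewrite /gibbs_dist (partition_fun_local e) (gibbs_weight_local s e).
Qed.

(** * Boundary vectors up to an additive constant at each vertex *)

Section Gauge.
Variables (i0 : 'I_q) (ht ht' : field) (c : G -> Qp hp).
Hypothesis sh : forall x i, small (ht x i).
Hypothesis sc : forall x, small (c x).
Hypothesis hE : forall x i, ht' x i = ht x i - c x.

Lemma gauge_small x i : small (ht' x i).
Proof. by rewrite hE smallB. Qed.

Definition gauge_factor n := \prod_(x <- sphere x0 n) padic_exp (c x).

Lemma gauge_factor_neq0 n : gauge_factor n != 0.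
Proof.
by rewrite prodf_seq_neq0; apply/allP => y _; apply/implyP => _; exact: exp_neq0.
Qed.

Lemma gibbs_weight_gauge n (s : config n) :
  gibbs_weight J ht s = gauge_factor n * gibbs_weight J ht' s.
Proof.
rewrite -(restrict_extend i0 s) gibbs_weight_restrict// gibbs_weight_restrict; last first.
  exact: gauge_small.
rewrite mulrCA; congr (_ * _); rewrite -big_split/=.
apply: eq_bigr => x _; rewrite -expD//; last exact: gauge_small.
by rewrite hE addrC subrK.
Qed.

Lemma partition_fun_gauge n :
  partition_fun x0 J ht n = gauge_factor n * partition_fun x0 J ht' n.
Proof. by rewrite mulr_sumr; apply: eq_bigr => s _; exact: gibbs_weight_gauge. Qed.

Lemma gibbs_dist_gauge n (s : config n) : gibbs_dist J ht s = gibbs_dist J ht' s.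
Proof.
rewrite /gibbs_dist partition_fun_gauge gibbs_weight_gauge invfM.
by rewrite mulrACA mulVf ?mul1r ?gauge_factor_neq0.
Qed.

(** Subtracting [c x] rescales all weights of one level by the same [gauge_factor], which the
    normalization cancels. This lets the vectors be made zero at a reference spin. *)
Lemma gibbs_measure_gauge (R : realType) (mu : cylinder x0 q -> Qp hp) :
  gibbs_measure R J ht mu -> gibbs_measure R J ht' mu.
Proof.
case=> _ Z0 cp pm muE; split; last 2 first.
- exact: pm.
- by move=> n s; rewrite muE gibbs_dist_gauge.
- by move=> x i; apply/exp_domainP/gauge_small.
- by move=> n; have := Z0 n; rewrite partition_fun_gauge mulf_eq0 negb_or => /andP[].
- move=> n s; rewrite -gibbs_dist_gauge -cp.
  by apply: eq_bigr => w _; rewrite gibbs_dist_gauge.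
Qed.

End Gauge.

End GibbsWeights.

(** * Two-valuedness and counting subsets *)

Lemma subr_expr_sums (F : comNzRingType) (u v : F) (k : nat) :
  \sum_(j < k) u ^+ j - \sum_(j < k) v ^+ j =
  (u - v) * \sum_(j < k) \sum_(i < j) u ^+ (j.-1 - i) * v ^+ i.
Proof.
rewrite -sumrB mulr_sumr; apply: eq_bigr => -[[|j] ?] _ /=.
  by rewrite !expr0 subrr big_ord0 mulr0.
by rewrite -subrXX.
Qed.

(* A solution x <> 1 of x - 1 = b (x^k - 1) satisfies 1 = b (1 + x + ... + x^(k-1)).
   The divided difference of the right-hand side at two solutions vanishes, but it
   is congruent to 1 + 2 + ... + (k-1) modulo p. *)
Lemma fixed_ratio_unique (p : nat) (hp : prime p) (k : nat) (b u v : Qp hp) :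
  ~~ (p %| 'C(k, 2))%N -> small (u - 1) -> small (v - 1) -> u != 1 -> v != 1 ->
  u - 1 = b * (u ^+ k - 1) -> v - 1 = b * (v ^+ k - 1) -> u = v.
Proof.
move=> pk su sv u1 v1 ue ve.
have sumE x : x != 1 -> x - 1 = b * (x ^+ k - 1) -> b * \sum_(j < k) x ^+ j = 1.
  move=> x1; rewrite subrX1 mulrCA -{1}[x - 1]mulr1 => e.
  by apply/esym; apply: mulfI e; rewrite subr_eq0.
have bu := sumE _ u1 ue; have bv := sumE _ v1 ve.
apply/eqP; rewrite -subr_eq0; apply/negPn/negP => uv.
have b0 : b != 0.
  by apply: contra_eq_neq bu => ->; rewrite mul0r eq_sym oner_eq0.
set T := \sum_(j < k) \sum_(i < j) u ^+ (j.-1 - i) * v ^+ i.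
have T0 : T = 0.
  apply: (mulfI uv); rewrite mulr0 /T -subr_expr_sums; apply: (mulfI b0).
  by rewrite mulrBr bu bv subrr mulr0.
(* The binomial coefficient is [T] with every monomial replaced by 1, and each monomial in [u] and
   [v] lies in E_p. *)
have kE : 'C(k, 2)%:R = \sum_(j < k) \sum_(i < j) (1 : Qp hp).
  rewrite -bin2_sum big_mkord natr_sum; apply: eq_bigr => j _.
  by rewrite sumr_const card_ord.
have : small ('C(k, 2)%:R : Qp hp).
  rewrite -smallN -[X in small X]add0r -T0 kE -sumrB.
  apply: small_sum => j _; rewrite -sumrB; apply: small_sum => i _.
  by rewrite small_sub1M// small_sub1X.
by move/small_nrm_lt1; rewrite nrm_nat_coprime// ltxx.
Qed.

Lemma card_subset_family (T : Type) (q m : nat) (P : {set 'I_q} -> T -> Prop) :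
  (forall M : {set 'I_q}, #|M| = m -> exists! v, P M v) ->
  (forall (M M' : {set 'I_q}) v, #|M| = m -> #|M'| = m -> P M v -> P M' v -> M = M') ->
  ([set v | exists2 M : {set 'I_q}, #|M| = m & P M v]%classic #= `I_'C(q, m))%card.
Proof.
move=> exP injP.
(* [T] may lack a default element, hence a choice function into [option T], free on sets of the
   wrong size. *)
have fex (M : {set 'I_q}) :
    exists y : option T, #|M| = m -> exists2 v, y = Some v & P M v.
  have [Mm|nM] := pselect (#|M| = m); last by exists None.
  by have [v [Pv _]] := exP M Mm; exists (Some v) => _; exists v.
have [f fP] := choice fex.
pose D := [set M : {set 'I_q} | #|M| = m]%classic.
have finj : {in D &, injective f}.
  move=> M M' /set_mem Mm /set_mem Mm' e.
  have [v fv Pv] := fP _ Mm; have [v' fv' Pv'] := fP _ Mm'.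
  by apply: (injP _ _ v) => //; move: fv'; rewrite -e fv => -[->].
have imE : ([set Some v | v in [set v | exists2 M : {set 'I_q}, #|M| = m & P M v]] =
    f @` D)%classic.
  apply/seteqP; split => [_ [v [M Mm Pv] <-]|_ [M Mm <-]] /=.
    exists M => //; have [v' -> Pv'] := fP _ Mm; congr Some.
    by have [w [_ wu]] := exP M Mm; rewrite -(wu _ Pv) -(wu _ Pv').
  by have [v -> Pv] := fP _ Mm; exists v => //; exists M.
apply: (card_eq_trans (B := (f @` D)%classic)).
  by rewrite -imE card_eq_sym; exact: card_some.
apply: (card_eq_trans (inj_card_eq finj)).
pose A := [set M : {set 'I_q} | #|M| == m].
have -> : D = [set` [fset M in enum A]%fset]%classic.
  by apply/seteqP; split => M /=; rewrite !inE mem_enum inE => /eqP.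
apply/card_eq_fsetP; rewrite -[in RHS](card_ord q) -card_draws cardE.
apply/perm_size/uniq_perm; rewrite ?fset_uniq ?enum_uniq// => M.
by rewrite !inE.
Qed.

(** * Measures on cylinder sets *)

Section CylinderMeasures.
Variables (p : nat) (hp : prime p).
Variables (k : nat) (G : cayley_tree k) (x0 : G) (q : nat).

Local Notation config n := {ffun ball x0 n -> 'I_q}.
Local Notation boundary n := {ffun sphere x0 n -> 'I_q}.
Local Notation restrict n := (@Defs.restrict k G x0 q n).
Local Notation cyl := (cylinder x0 q).
Implicit Types (mu : cyl -> Qp hp) (A : set (G -> 'I_q)).

Lemma cylinder_sum mu n (B : {set config n}) (A : cyl) :
  padic_probability mu -> sval A = [set sigma | restrict n sigma \in B]%classic ->
  mu A = \sum_(s in B) mu (config_cylinder s).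
Proof.
move=> [add _]; have [m] := ubnP #|B|; elim: m B A => // m IHm B A.
rewrite ltnS => Bm AB; have [B0|[s sB]] := set_0Vmem B.
  have A0 : sval A = set0 by rewrite AB B0; apply/seteqP; split => x //=; rewrite inE.
  have : mu A = mu A + mu A by apply: add; rewrite A0 ?set0I ?set0U.
  by rewrite B0 big_set0 -{1}[mu A]addr0 => /addrI.
pose A' : cyl := exist _ [set sigma | restrict n sigma \in B :\ s]%classic
  (ex_intro _ n (ex_intro _ (B :\ s) erefl)).
rewrite (big_setD1 s)//= -(IHm _ A')//; last first.
  by move: Bm; rewrite (cardsD1 s B) sB.
apply: add => /=; first by apply/seteqP; split => x //= [] /set1P ->; rewrite !inE eqxx.
rewrite AB; apply/seteqP; split => x /=.
  by move=> xB; have [e|e] := eqVneq (restrict n x) s; [left|right]; rewrite !inE ?e ?eqxx.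
by move=> [/set1P -> //|]; rewrite inE => /andP[].
Qed.

Lemma cylinder_measure_ext mu mu' : padic_probability mu -> padic_probability mu' ->
  (forall n (s : config n), mu (config_cylinder s) = mu' (config_cylinder s)) ->
  mu = mu'.
Proof.
move=> pm pm' e; apply/funext => -[A [n [B AB]]].
rewrite (cylinder_sum (B := B) pm)// (cylinder_sum (B := B) pm')//.
by apply: eq_bigr => s _; exact: e.
Qed.

Lemma restrict_extend_concat i0 n (s : config n) (w : boundary n.+1) :
  restrict n (extend i0 (concat s w)) = s.
Proof.
apply/ffunP => x; have xS : val x \in ball x0 n.+1.
  by have := valP x; rewrite !in_ball => /leqW.
by rewrite ffunE /extend insubT ffunE /= valK.
Qed.

Section Extension.
Variables (i0 : 'I_q) (g : forall n, config n -> Qp hp).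
Hypothesis g_sum1 : forall n, \sum_s g (n := n) s = 1.
Hypothesis g_compat : forall n (s : config n),
  \sum_(w : boundary n.+1) g (concat s w) = g s.

Definition determined n A : Prop :=
  forall sigma tau, restrict n sigma = restrict n tau -> A sigma -> A tau.

Lemma restrict_le n m sigma tau : (n <= m)%N ->
  restrict m sigma = restrict m tau -> restrict n sigma = restrict n tau.
Proof.
move=> nm /ffunP e; apply/ffunP => x; have xm : val x \in ball x0 m.
  by have := valP x; rewrite !in_ball => /leq_trans; apply.
by have := e [` xm]%fset; rewrite !ffunE.
Qed.

(** The filling by [i0] outside [V_n] is immaterial once [V_n] determines [A]. *)
Definition level_mass n A : Qp hp := \sum_(s : config n | `[< A (extend i0 s) >]) g s.

Lemma level_mass_le n m A : determined n A -> (n <= m)%N ->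
  level_mass m A = level_mass n A.
Proof.
move=> dA /subnKC <-; elim: (m - n)%N => [|d IHd]; first by rewrite addn0.
rewrite addnS -{}IHd /level_mass big_mkcond [RHS]big_mkcond sum_configS.
apply: eq_bigr => s _; rewrite -g_compat.
have e (w : boundary (n + d).+1) :
    `[< A (extend i0 (concat s w)) >] = `[< A (extend i0 s) >].
  apply/asboolP/asboolP; apply: dA; apply: (@restrict_le _ (n + d)); rewrite ?leq_addr//.
    by rewrite restrict_extend_concat restrict_extend.
  by rewrite restrict_extend_concat restrict_extend.
under eq_bigr => w _ do rewrite e.
by case: asboolP => // _; rewrite big1.
Qed.

Lemma cylinder_determined (A : cyl) : exists n, determined n (sval A).
Proof.
by case: A => A [n [B AB]]; exists n => sigma tau /= e; rewrite AB /= e.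
Qed.

(** A finitely additive Kolmogorov extension: each cylinder is weighed at some level that determines
    it, and by [level_mass_le] any two or three cylinders can be compared at a common level. *)
Lemma cylinder_extension : exists mu, padic_probability mu /\
  forall n (s : config n), mu (config_cylinder s) = g s.
Proof.
have [lv lvP] := choice cylinder_determined.
exists (fun A : cyl => level_mass (lv A) (sval A)); split; last first.
  move=> n s; set A := config_cylinder s.
  have dn : determined n (sval A) by move=> sigma tau /= ->.
  rewrite -(level_mass_le (lvP A) (leq_maxl _ n)) (level_mass_le dn) ?leq_maxr//.
  rewrite /level_mass (big_pred1 s)// => s' /=; apply/asboolP/eqP => /=.
    by rewrite restrict_extend => /set1P.
  by move=> ->; rewrite restrict_extend set11.
split=> [A B C AB0 CE|A AT]; last first.
  rewrite AT /level_mass -(g_sum1 (lv A)); apply: eq_bigl => s.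
  by apply/asboolP.
pose m := maxn (lv A) (maxn (lv B) (lv C)).
have mA : (lv A <= m)%N by rewrite leq_maxl.
have mB : (lv B <= m)%N by rewrite /m (leq_trans (leq_maxl _ (lv C))) ?leq_maxr.
have mC : (lv C <= m)%N by rewrite /m (leq_trans (leq_maxr (lv B) _)) ?leq_maxr.
rewrite -(level_mass_le (lvP A) mA) -(level_mass_le (lvP B) mB).
rewrite -(level_mass_le (lvP C) mC) /level_mass CE.
rewrite (bigID (fun s : config m => `[< sval A (extend i0 s) >]))/=.
congr (_ + _); apply: eq_bigl => s; apply/andP/asboolP.
- by case=> _ /asboolP.
- by move=> h; split; apply/asboolP => //; left.
- by case=> /asboolP[h|//] /asboolP.
- move=> h; split; apply/asboolP; first by right.
  by move=> h'; have : (sval A `&` sval B)%classic (extend i0 s) by []; rewrite AB0.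
Qed.

End Extension.
End CylinderMeasures.

(** * The reduced equation *)

(** Two configurations that differ at [x] alone share all other factors, which cancel. *)
Lemma prod_update_ratio (F : fieldType) (T : eqType) (I : Type) (S : seq T)
    (f g : T -> I -> F) (C C' : F) (x : T) (i l : I) :
  uniq S -> x \in S -> C' != 0 -> (forall y j, g y j != 0) ->
  (forall tau : T -> I,
     C * \prod_(y <- S) f y (tau y) = C' * \prod_(y <- S) g y (tau y)) ->
  f x i * g x l = f x l * g x i.
Proof.
move=> uS xS C0 g0 e; pose tau j y := if y == x then j else l.
have prodE (h : T -> I -> F) j : \prod_(y <- S) h y (tau j y) =
    h x j * \prod_(y <- S | y != x) h y l.
  rewrite (bigD1_seq x)//= {1}/tau eqxx; congr (_ * _).
  by apply: eq_bigr => y /negbTE yx; rewrite /tau yx.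
have ei := e (tau i); have el := e (tau l); rewrite !prodE in ei el.
have Q0 : \prod_(y <- S | y != x) g y l != 0.
  by rewrite prodf_seq_neq0; apply/allP => y _; rewrite g0 implybT.
set P := \prod_(y <- S | _) f y l in ei el; set Q := \prod_(y <- S | _) g y l in Q0 ei el.
(* The common factor on the side of [f] could vanish a priori; the nonzero side of [g] excludes
   it. *)
have [P0|P0] := eqVneq (C * P) 0.
  have : C' * (g x i * Q) != 0 by rewrite !mulf_neq0.
  by rewrite -ei mulrCA P0 mulr0 eqxx.
apply: (mulfI P0).
have -> : C * P * (f x i * g x l) = C * (f x i * P) * g x l by ring.
have -> : C * P * (f x l * g x i) = C * (f x l * P) * g x i by ring.
by rewrite ei el; ring.
Qed.

Section TranslationInvariant.
Variables (p : nat) (hp : prime p) (R : realType).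
Variables (k : nat) (G : cayley_tree k) (x0 : G) (q : nat) (J : Qp hp).
Hypothesis sJ : small J.

Local Notation config n := {ffun ball x0 n -> 'I_q}.
Local Notation boundary n := {ffun sphere x0 n -> 'I_q}.
Local Notation restrict n := (@Defs.restrict k G x0 q n).
Local Notation field := (G -> {ffun 'I_q -> Qp hp}).
Local Notation theta := (padic_exp J).
Implicit Types (ht : field) (mu : cylinder x0 q -> Qp hp) (M : {set 'I_q}).

Lemma root_sphere : x0 \in sphere x0 0.
Proof. by rewrite in_sphere distxx. Qed.

Lemma sphere1_nonempty : exists y, y \in sphere x0 1.
Proof.
have := count_children root_sphere; rewrite /branching eqxx addn1 => c.
have : has (fun y => parent x0 y == x0) (sphere x0 1) by rewrite has_count c.
by move=> /hasP[y y1 _]; exists y.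
Qed.

Lemma gibbs_measure_small ht mu : gibbs_measure R J ht mu ->
  forall x i, small (ht x i).
Proof. by case=> sh _ _ _ _ x i; apply/exp_domainP/sh. Qed.

(** The reference spin [l] is arbitrary because complementing the set of spins will change it. *)
Lemma reduced_equation ht mu (l : 'I_q) (d : 'I_q -> Qp hp) :
  gibbs_measure R J ht mu ->
  (forall y, y != x0 -> forall j, ht y j - ht y l = d j) ->
  let t j := padic_exp (d j) in let s := \sum_j t j in
  s + (theta - 1) != 0 /\
  forall i, let u := (s + (theta - 1) * t i) / (s + (theta - 1)) in
    small (u - 1) /\ t i = u ^+ k.
Proof.
move=> gm hd t s; have sh := gibbs_measure_small gm; have [_ Z0 cp _ _] := gm.
have [y0 y0S] := sphere1_nonempty; have y0x := sphere_neq_root y0S.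
have e0 y j : padic_exp (ht y j) != 0 := exp_neq0 (sh y j).
have tE y j : y != x0 -> padic_exp (ht y j) = padic_exp (ht y l) * t j.
  by move=> yx; rewrite -expD// /t -?(hd y yx) ?smallB// addrC subrK.
have tl : t l = 1 by rewrite /t -(hd _ y0x) subrr exp0.
pose a i := s + (theta - 1) * t i.
have level n tau : (partition_fun x0 J ht n.+1)^-1 *
      \prod_(y <- sphere x0 n.+1) padic_exp (ht y l) *
      \prod_(x <- sphere x0 n) a (tau x) ^+ branching k n =
    (partition_fun x0 J ht n)^-1 * \prod_(x <- sphere x0 n) padic_exp (ht x (tau x)).
  have /(compatibleP x0 sJ l sh)/(_ n tau) := cp.
  by rewrite (child_prod (e := fun y => padic_exp (ht y l)) J n tau tE) mulrA.
have ZV0 n : (partition_fun x0 J ht n)^-1 != 0 by rewrite invr_eq0 Z0.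
have flip n x i : x \in sphere x0 n ->
    a i ^+ branching k n * padic_exp (ht x l) = a l ^+ branching k n * padic_exp (ht x i).
  move=> xS; exact: (@prod_update_ratio _ _ _ _ (fun _ i => a i ^+ branching k n)
    (fun y j => padic_exp (ht y j)) _ _ x i l (fset_uniq _) xS (ZV0 n) e0 (level n)).
have al : a l = s + (theta - 1) by rewrite /a tl mulr1.
(* If this vanished, the configuration constantly [l] would make the left side of [level] zero at
   level 0, while the right side is not. *)
have D0 : s + (theta - 1) != 0.
  rewrite -al; apply/negP => /eqP a0.
  have : (partition_fun x0 J ht 0)^-1 *
      \prod_(x <- sphere x0 0) padic_exp (ht x l) != 0.
    by rewrite mulf_neq0// prodf_seq_neq0; apply/allP => y _; rewrite e0.
  rewrite -(level 0%N (fun=> l)) [X in _ * X](bigD1_seq x0) ?root_sphere ?fset_uniq//=.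
  by rewrite a0 /branching eqxx addn1 exprS mul0r mul0r mulr0 eqxx.
split=> // i u.
have power n x : x \in sphere x0 n ->
    u ^+ branching k n = padic_exp (ht x i) / padic_exp (ht x l).
  move=> xS; apply: (mulIf (e0 x l)); rewrite divfK ?e0//.
  rewrite /u expr_div_n -/(a i) mulrAC flip// al mulrAC divff ?mul1r//.
  exact: expf_neq0.
have uk : u ^+ k = t i.
  have := power _ _ y0S; rewrite /branching addn0 => ->.
  by rewrite tE// mulrAC divff ?mul1r.
split; last by rewrite uk.
(* Level 0 has exponent [k + 1], and the entries of the root vector lie in the disc; dividing by
   [u ^+ k] then puts [u] itself in E_p. *)
have uS : u ^+ k.+1 = padic_exp (ht x0 i - ht x0 l).
  by have := power _ _ root_sphere; rewrite /branching eqxx addn1 => ->; rewrite expB.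
have t0 : t i != 0.
  by rewrite /t -(hd _ y0x) exp_neq0// smallB.
have -> : u = padic_exp (ht x0 i - ht x0 l) * (t i)^-1.
  by rewrite -uS exprS uk mulfK.
apply: small_sub1M; first exact: small_exp (smallB (sh _ _) (sh _ _)).
apply: small_sub1V; rewrite /t -(hd _ y0x).
exact: small_exp (smallB (sh _ _) (sh _ _)).
Qed.
End TranslationInvariant.

(** * Classification of translation-invariant measures *)

Lemma sum_indicator_exp (F : comNzRingType) (q : nat) (M : {set 'I_q}) (z : F) :
  \sum_j z ^+ (j \in M) = #|M|%:R * z + (q%:R - #|M|%:R).
Proof.
rewrite (bigID (mem M))/=; congr (_ + _).
  rewrite (eq_bigr (fun=> z)) => [|j ->]; last by rewrite expr1.
  by rewrite sumr_const mulr_natl.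
rewrite (eq_bigr (fun=> 1)) => [|j /negbTE ->]; last by rewrite expr0.
rewrite sumr_const -[X in X%:R - _](card_ord q) -(cardC (mem M)) natrD.
by rewrite addrAC subrr add0r.
Qed.

Lemma potts_ratioE (F : fieldType) (q : nat) (M : {set 'I_q}) (theta z : F) :
  let s := \sum_j z ^+ (j \in M) in
  (s + (theta - 1) * z) / (s + (theta - 1)) = potts_ratio q #|M| theta z.
Proof. by rewrite /= sum_indicator_exp /potts_ratio; congr (_ / _); ring. Qed.

Section Classification.
Variables (p : nat) (hp : prime p) (R : realType).
Variables (k : nat) (G : cayley_tree k) (x0 : G) (q : nat) (J : Qp hp).
Hypothesis sJ : small J.
Hypothesis pk : ~~ (p %| 'C(k, 2))%N.
Hypothesis hq : (2 <= q)%N.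

Local Notation field := (G -> {ffun 'I_q -> Qp hp}).
Local Notation theta := (padic_exp J).
Implicit Types (ht : field) (mu : cylinder x0 q -> Qp hp) (M : {set 'I_q}).

Lemma reduced_two_valued ht mu (l : 'I_q) (d : 'I_q -> Qp hp) :
  gibbs_measure R J ht mu ->
  (forall y, y != x0 -> forall j, ht y j - ht y l = d j) ->
  forall i j, d i != 0 -> d j != 0 -> d i = d j.
Proof.
move=> gm hd; have [D0 hu] := reduced_equation sJ gm hd.
have sh := gibbs_measure_small gm; have [y0 /sphere_neq_root y0x] := sphere1_nonempty x0.
have sd i : small (d i) by rewrite -(hd _ y0x) smallB.
move: hu; set D := _ + (theta - 1) in D0 *; set s := \sum_j _ => hu i j di dj.
pose u i := (s + (theta - 1) * padic_exp (d i)) / D.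
have su i' : small (u i' - 1) by have [] := hu i'.
have tu i' : padic_exp (d i') = u i' ^+ k by have [] := hu i'.
have u1 i' : d i' != 0 -> u i' != 1.
  by apply: contra_neq => e; apply/eqP; rewrite -exp_eq1// tu e expr1n.
(* The factor [(theta - 1) / D] is the same for all spins, as [fixed_ratio_unique] requires. *)
have ub i' : u i' - 1 = (theta - 1) / D * (u i' ^+ k - 1).
  apply: (mulIf D0); rewrite -tu mulrBl /u divfK// mul1r [RHS]mulrAC divfK//.
  by rewrite [D in LHS](_ : D = s + (theta - 1))//; ring.
apply: exp_inj => //; rewrite !tu; congr (_ ^+ _).
exact: (fixed_ratio_unique pk (su i) (su j) (u1 _ di) (u1 _ dj) (ub i) (ub j)).
Qed.

Lemma indicator_reduction ht mu :
  gibbs_measure R J ht mu -> translation_invariant x0 ht ->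
  exists M l h, [/\ (1 <= #|M| <= q %/ 2)%N, l \notin M
    & forall y, y != x0 -> forall j, ht y j - ht y l = h * (j \in M)%:R].
Proof.
move=> gm ti; have [y0 /sphere_neq_root y0x] := sphere1_nonempty x0.
have ql : (q.-1 < q)%N by lia.
pose l1 := Ordinal ql; pose d j := ht y0 j - ht y0 l1.
have hd y : y != x0 -> forall j, ht y j - ht y l1 = d j by move=> yx j; apply: ti.
have two := reduced_two_valued gm hd.
pose M' := [set j | d j != 0].
have l1M : l1 \notin M' by rewrite inE negbK /d subrr.
have [M0|[i1 i1M]] := set_0Vmem M'.
  (* All reduced entries vanish: with [h = 0] any singleton meets the size bounds. *)
  have q0 : (0 < q)%N by lia.
  pose i0 := Ordinal q0.
  have il : i0 != l1 by rewrite -val_eqE /=; lia.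
  exists [set i0], l1, 0; split=> [||y yx j].
  - by rewrite cards1; lia.
  - by rewrite inE eq_sym.
  - rewrite mul0r hd//; apply/eqP; have : j \notin M' by rewrite M0 inE.
    by rewrite inE negbK.
have dE j : d j = d i1 * (j \in M')%:R.
  case: (boolP (j \in M')) => [jM|]; last by rewrite inE negbK mulr0 => /eqP.
  by rewrite mulr1; apply: two; [move: jM|move: i1M]; rewrite inE.
have [Mq|Mq] := leqP #|M'| (q %/ 2).
  exists M', l1, (d i1); split=> [||y yx j]; rewrite ?hd//.
  by rewrite Mq andbT card_gt0; apply/set0Pn; exists i1.
(* Taking a spin of [M'] as the new reference makes the entries zero on [M'] and [- d i1] on its
   complement, which contains [l1]. *)
exists (~: M'), i1, (- d i1); split=> [||y yx j].
- have := cardsC M'; rewrite card_ord => MC.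
  have : (0 < #|~: M'|)%N by rewrite card_gt0; apply/set0Pn; exists l1; rewrite inE.
  by move: Mq MC; move: #|M'| #|~: M'| => a b; lia.
- by rewrite inE negbK.
- have -> : ht y j - ht y i1 = (ht y j - ht y l1) - (ht y i1 - ht y l1) by ring.
  rewrite !hd// [d j]dE finset.in_setC; case: (j \in M'); first by rewrite !mulr1 mulr0 subrr.
  by rewrite mulr0 mulr1 sub0r.
Qed.

Lemma TIpGM_classification mu : TIpGM R J mu ->
  exists M h, [/\ (1 <= #|M| <= q %/ 2)%N, small h,
      small (potts_ratio q #|M| theta (padic_exp h) - 1),
      padic_exp h = potts_ratio q #|M| theta (padic_exp h) ^+ k
    & gibbs_measure_ind R J h M mu].
Proof.
case=> ht [gm ti]; have [M [l [h [Mq lM hM]]]] := indicator_reduction gm ti.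
have [i iM] : exists i, i \in M by apply/set0Pn; rewrite -card_gt0; case/andP: Mq.
have sh := gibbs_measure_small gm; have [y0 /sphere_neq_root y0x] := sphere1_nonempty x0.
have hE : h = ht y0 i - ht y0 l by rewrite hM// iM mulr1.
have sh' : small h by rewrite hE smallB.
have [D0 /(_ i)] := reduced_equation sJ gm hM.
rewrite iM mulr1; under eq_bigr => j _ do rewrite exp_bool.
rewrite potts_ratioE => -[su zu]; exists M, h; split=> //.
(* The root vector stays as it is, since [gibbs_measure_ind] constrains only the other vertices. *)
pose c x := if x == x0 then 0 else ht x l.
exists (fun x => [ffun j => ht x j - c x]); split; last first.
  move=> x xx; apply/ffunP => j; rewrite !ffunE /c (negbTE xx).
  exact: hM.
apply: (gibbs_measure_gauge sJ l sh _ _ gm (c := c)).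
  by move=> x; rewrite /c; case: ifP => // _; exact: small0.
by move=> x j; rewrite ffunE.
Qed.

End Classification.

(** * Construction of the measures *)

Section Construction.
Variables (p : nat) (hp : prime p) (R : realType).
Variables (k : nat) (G : cayley_tree k) (x0 : G) (q : nat) (J : Qp hp).
Hypothesis sJ : small J.
Hypothesis k0 : (0 < k)%N.

Local Notation config n := {ffun ball x0 n -> 'I_q}.
Local Notation boundary n := {ffun sphere x0 n -> 'I_q}.
Local Notation restrict n := (@Defs.restrict k G x0 q n).
Local Notation field := (G -> {ffun 'I_q -> Qp hp}).
Local Notation theta := (padic_exp J).
Implicit Types (ht : field) (mu : cylinder x0 q -> Qp hp).

Variables (h : Qp hp) (M : {set 'I_q}) (l : 'I_q).
Hypothesis sh : small h.
Local Notation z := (padic_exp h).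
Local Notation u := (potts_ratio q #|M| theta z).
Hypothesis su : small (u - 1).
Hypothesis zu : z = u ^+ k.
Hypothesis Zpos : forall n, (0 < n)%N ->
  partition_fun x0 J (fun=> scaled_indicator h M) n != 0.

(* u = exp (h / k), and the root, having k + 1 children, requires the weight
   u ^ (k + 1) where the other vertices require u ^ k. *)
Definition indicator_field : field := fun x =>
  scaled_indicator (if x == x0 then k.+1%:R * (h / k%:R) else h) M.

Local Notation ht := indicator_field.

Lemma small_indicator_field x i : small (ht x i).
Proof.
have [shk _] := exp_root k0 su sh (esym zu).
by rewrite ffunE; apply: small_bool; case: ifP => // _; exact: small_mulrn.
Qed.

(** The two cases of the field match the two values of [branching], so the root needs no separate
    treatment below. *)
Lemma exp_indicator_field n x i : x \in sphere x0 n ->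
  padic_exp (ht x i) = (u ^+ (i \in M)) ^+ branching k n.
Proof.
have [shk ehk] := exp_root k0 su sh (esym zu).
move=> xn; rewrite ffunE exp_bool exprAC; congr (_ ^+ _).
have -> : (x == x0) = (n == 0%N) by rewrite -level_eq0; move: xn; rewrite in_sphere => /eqP ->.
rewrite /branching; case: (n == 0%N); last by rewrite addn0.
by rewrite exp_natmul// ehk addn1.
Qed.

Definition ratio_denominator : Qp hp := \sum_j z ^+ (j \in M) + (theta - 1).
Local Notation B := ratio_denominator.

(** By the convention [0^-1 = 0], a zero denominator would give [u = 0], which is not in E_p. *)
Lemma ratio_denominator_neq0 : B != 0.
Proof.
have := small_sub1_neq0 su; rewrite -potts_ratioE -/B.
by apply: contra_neq => ->; rewrite invr0 mulr0.
Qed.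

Lemma vertex_factor i :
  \sum_j z ^+ (j \in M) + (theta - 1) * z ^+ (i \in M) = B * u ^+ (i \in M).
Proof.
case: (i \in M); last by rewrite !expr0 !mulr1.
by rewrite !expr1 -potts_ratioE [RHS]mulrC divfK ?ratio_denominator_neq0.
Qed.

Definition level_factor n : Qp hp := \prod_(x <- sphere x0 n) B ^+ branching k n.

Lemma level_factor_neq0 n : level_factor n != 0.
Proof.
rewrite prodf_seq_neq0; apply/allP => x _; apply/implyP => _.
exact: expf_neq0 ratio_denominator_neq0.
Qed.

Lemma indicator_child_prod n tau :
  \prod_(y <- sphere x0 n.+1) child_sum J ht y (tau (parent x0 y)) =
  level_factor n * boundary_weight x0 ht n tau.
Proof.
rewrite (@child_prod _ _ _ _ x0 _ J ht (fun=> 1) (fun j => z ^+ (j \in M))); last first.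
  by move=> y j /negbTE yx; rewrite ffunE yx exp_bool mul1r.
rewrite big1 // mul1r /level_factor /boundary_weight -big_split/=.
apply: eq_big_seq => x xn; rewrite vertex_factor exprMn.
by rewrite (exp_indicator_field _ xn).
Qed.

Lemma sum_concat_indicator n (s : config n) :
  \sum_(w : boundary n.+1) gibbs_weight J ht (concat s w) =
  level_factor n * gibbs_weight J ht s.
Proof.
rewrite -(restrict_extend l s).
rewrite (sum_concat x0 sJ n (extend l s) small_indicator_field).
rewrite (gibbs_weight_restrict x0 sJ n (extend l s) small_indicator_field).
by rewrite indicator_child_prod mulrCA.
Qed.

Lemma partition_fun_indicatorS n :
  partition_fun x0 J ht n.+1 = level_factor n * partition_fun x0 J ht n.
Proof.
rewrite partition_funS mulr_sumr; apply: eq_bigr => s _.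
exact: sum_concat_indicator.
Qed.

(** From level 1 on, the constant field of [Zpos] agrees with [ht]; level 0 follows because its
    normalizing factor divides that of level 1. *)
Lemma partition_fun_indicator_neq0 n : partition_fun x0 J ht n != 0.
Proof.
have pos m : (0 < m)%N -> partition_fun x0 J ht m != 0.
  case: m => // m _; rewrite (partition_fun_local J (ht' := fun=> scaled_indicator h M)).
    exact: Zpos.
  by move=> x /sphere_neq_root/negbTE xx; rewrite /indicator_field xx.
case: n => [|n]; last exact: pos.
by have := pos 1%N isT; rewrite partition_fun_indicatorS mulf_eq0 negb_or => /andP[].
Qed.

Lemma compatible_indicator : compatible x0 J ht.
Proof.
move=> n s; rewrite /gibbs_dist -mulr_sumr sum_concat_indicator.
rewrite partition_fun_indicatorS invfM mulrACA mulVf ?mul1r//.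
exact: level_factor_neq0.
Qed.

Lemma gibbs_measure_ind_exists : exists mu, gibbs_measure_ind R J h M mu.
Proof.
have sum1 n : \sum_(s : config n) gibbs_dist J ht s = 1.
  by rewrite -mulr_sumr mulVf// partition_fun_indicator_neq0.
have [mu [pm muE]] := cylinder_extension l sum1 compatible_indicator.
exists mu, ht; split; last by move=> x /negbTE xx; rewrite /indicator_field xx.
split; last 2 first.
- exact: pm.
- exact: muE.
- by move=> x i; apply/exp_domainP/small_indicator_field.
- exact: partition_fun_indicator_neq0.
- exact: compatible_indicator.
Qed.

(** The field behind [mu] may differ from [ht] at the root, so the distributions are first matched
    at level [n + 1]; compatibility of both carries this down to level [n]. *)
Lemma gibbs_measure_indE mu n (s : config n) : gibbs_measure_ind R J h M mu ->
  mu (config_cylinder s) = gibbs_dist J ht s.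
Proof.
case=> ht' [[_ _ cp _ ->] hE].
have levS m (s' : config m.+1) : gibbs_dist J ht' s' = gibbs_dist J ht s'.
  apply: gibbs_dist_local => x /sphere_neq_root xx.
  by rewrite hE// /indicator_field (negbTE xx).
rewrite -cp -(compatible_indicator s).
by apply: eq_bigr => w _; exact: levS.
Qed.

Lemma gibbs_measure_ind_unique mu mu' :
  gibbs_measure_ind R J h M mu -> gibbs_measure_ind R J h M mu' -> mu = mu'.
Proof.
move=> im im'; have [_ [[_ _ _ pm _] _]] := im; have [_ [[_ _ _ pm' _] _]] := im'.
apply: (cylinder_measure_ext pm pm') => n s.
by rewrite (gibbs_measure_indE s im) (gibbs_measure_indE s im').
Qed.

Lemma gibbs_measure_ind_TI mu : gibbs_measure_ind R J h M mu -> TIpGM R J mu.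
Proof.
case=> ht' [gm hE]; exists ht'; split=> [|x y xx yx i j _]; first exact: gm.
by rewrite !hE.
Qed.

Definition root_config (i : 'I_q) : config 0 := restrict 0 (fun=> i).

Lemma root_mass : exists2 c, c != 0 &
  forall mu i, gibbs_measure_ind R J h M mu ->
    mu (config_cylinder (root_config i)) = c * (u ^+ (i \in M)) ^+ k.+1.
Proof.
exists ((partition_fun x0 J ht 0)^-1 * interaction x0 J 0 (fun=> l)).
  by rewrite mulf_neq0 ?invr_eq0 ?partition_fun_indicator_neq0// interaction_neq0.
move=> mu i im; rewrite (gibbs_measure_indE _ im) /gibbs_dist -mulrA.
rewrite (gibbs_weight_restrict x0 sJ 0 (fun=> i) small_indicator_field).
(* In a constant configuration all neighbours agree, whatever the spin. *)
have -> : interaction x0 J 0 (fun=> i) = interaction x0 J 0 (fun=> l).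
  by apply: eq_bigr => y _; rewrite !eqxx.
congr (_ * (_ * _)); rewrite /boundary_weight.
rewrite (eq_big_seq (fun x => if x == x0 then (u ^+ (i \in M)) ^+ k.+1 else 1)).
  by rewrite -big_mkcond -big_filter filter_pred1_uniq ?fset_uniq ?root_sphere// big_seq1.
move=> x x1; rewrite (exp_indicator_field _ x1) /branching eqxx addn1.
by rewrite -level_eq0; move: x1; rewrite in_sphere => ->.
Qed.

End Construction.

(* Exchanging a spin in M outside M' with one in M' outside M would force
   u ^ (2 (k + 1)) = 1 for the ratio u of the root masses. *)
Lemma gibbs_measure_ind_inj (p : nat) (hp : prime p) (R : realType)
    (k : nat) (G : cayley_tree k) (x0 : G) (q m : nat) (J h : Qp hp)
    (M M' : {set 'I_q}) (mu : cylinder x0 q -> Qp hp) :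
  small J -> small h -> (0 < k)%N -> #|M| = m -> #|M'| = m ->
  let u := potts_ratio q m (padic_exp J) (padic_exp h) in
  small (u - 1) -> padic_exp h = u ^+ k -> padic_exp h != 1 ->
  (forall (N : {set 'I_q}) n, #|N| = m -> (0 < n)%N ->
     partition_fun x0 J (fun=> scaled_indicator h N) n != 0) ->
  gibbs_measure_ind R J h M mu -> gibbs_measure_ind R J h M' mu -> M = M'.
Proof.
move=> sJ sh k0 Mm Mm' u su zu z1 Zpos im im'.
apply/eqP; rewrite eqEcard Mm Mm' leqnn andbT; apply/fintype.subsetP => i iM.
apply/negPn/negP => iM'.
have mass (N : {set 'I_q}) : #|N| = m -> gibbs_measure_ind R J h N mu ->
    exists2 c, c != 0 & forall j,
      mu (config_cylinder (root_config x0 j)) = c * (u ^+ k.+1) ^+ (j \in N).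
  move=> Nm imN.
  have suN : small (potts_ratio q #|N| (padic_exp J) (padic_exp h) - 1) by rewrite Nm.
  have zuN : padic_exp h = potts_ratio q #|N| (padic_exp J) (padic_exp h) ^+ k.
    by rewrite Nm.
  have [c c0 cE] := root_mass R sJ k0 i sh suN zuN (fun n => Zpos N n Nm).
  by exists c => // j; rewrite (cE mu j imN) Nm -/u exprAC.
have [c c0 cE] := mass _ Mm im; have [c' c0' cE'] := mass _ Mm' im'.
(* As [M] and [M'] have equal size, [M'] cannot be a proper subset of [M]. *)
have [j jM' jM] : exists2 j, j \in M' & j \notin M.
  apply/fintype.subsetPn; apply: contra iM' => M'M.
  by have /eqP -> : M' == M by rewrite eqEcard M'M Mm Mm' leqnn.
set U := u ^+ k.+1 in cE cE'.
have ei : c * U = c'.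
  by have := cE i; rewrite cE' iM (negbTE iM') expr0 mulr1 expr1.
have ej : c = c' * U.
  by have := cE j; rewrite cE' jM' (negbTE jM) expr0 mulr1 expr1.
have U2 : u ^+ (k.+1 * 2) = 1.
  apply: (mulfI c0); rewrite exprM -/U expr2 mulrA ei -ej mulr1 //.
have u1 : u = 1 by apply: unit_torsion_free su U2; rewrite muln_gt0.
by move: z1; rewrite zu u1 expr1n eqxx.
Qed.

Lemma scaled_indicator_inj (p : nat) (hp : prime p) (q : nat) (h : Qp hp)
    (M M' : {set 'I_q}) : h != 0 ->
  scaled_indicator h M = scaled_indicator h M' -> M = M'.
Proof.
move=> h0 /ffunP e; apply/setP => i; have := e i; rewrite !ffunE.
move=> /(mulfI h0); case: (i \in M); case: (i \in M') => //= /eqP.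
  by rewrite oner_eq0.
by rewrite eq_sym oner_eq0.
Qed.

Theorem corollary1 (p : nat) (hp : prime p) (R : realType)
    (k : nat) (hk : (2 < k)%N) (hkp : ((k ^ 2 - k) %/ 2 != 0 %[mod p])%N)
    (G : cayley_tree k) (x0 : G) (q : nat) (hq : (2 <= q)%N)
    (J : Qp hp) (hJ : exp_domain R J) :
  (forall mu : cylinder x0 q -> Qp hp, TIpGM R J mu ->
     exists (m : nat) (M : {set 'I_q}) (h : Qp hp),
       [/\ (1 <= m <= q %/ 2)%N, #|M| = m, exp_domain R h
         & [/\ calE R (Qp_exp h),
               calE R (potts_ratio q m (Qp_exp J) (Qp_exp h)),
               Qp_exp h = potts_ratio q m (Qp_exp J) (Qp_exp h) ^+ k
             & gibbs_measure_ind R J h M mu]])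
  /\
  (forall (m : nat) (h : Qp hp), (1 <= m <= q %/ 2)%N ->
     exp_domain R h -> calE R (Qp_exp h) ->
     Qp_exp h = potts_ratio q m (Qp_exp J) (Qp_exp h) ^+ k ->
     (Qp_exp h != 1 ->
        ([set v | exists2 M : {set 'I_q}, #|M| = m &
                    v = scaled_indicator h M]%classic #= `I_'C(q, m))%card) /\
     (calE R (potts_ratio q m (Qp_exp J) (Qp_exp h)) ->
      (forall (M : {set 'I_q}) (n : nat), #|M| = m -> (0 < n)%N ->
         partition_fun x0 J (fun=> scaled_indicator h M) n != 0) ->
      (forall M : {set 'I_q}, #|M| = m ->
         (exists! mu, gibbs_measure_ind (x0 := x0) R J h M mu) /\
         (forall mu : cylinder x0 q -> Qp hp,
            gibbs_measure_ind R J h M mu -> TIpGM R J mu)) /\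
      (Qp_exp h != 1 ->
         ([set mu : cylinder x0 q -> Qp hp | exists2 M : {set 'I_q}, #|M| = m &
                     gibbs_measure_ind R J h M mu]%classic #= `I_'C(q, m))%card))).
Proof.
have k0 : (0 < k)%N := ltnW (ltnW hk).
have sJ : small J by apply/(exp_domainP R).
have pk : ~~ (p %| 'C(k, 2))%N.
  move: hkp; rewrite mod0n /dvdn bin2 -divn2.
  by have -> : (k ^ 2 - k = k * k.-1)%N by rewrite -subn1 mulnBr muln1 mulnn.
have i0 : 'I_q := Ordinal (ltnW hq).
split=> [mu|m h mq /exp_domainP sh _]; rewrite ?padic_expE.
  move=> /(TIpGM_classification sJ pk hq)[M [h [Mq sh su zu im]]].
  exists #|M|, M, h; rewrite !padic_expE; split; [exact: Mq|by []| |split].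
  - exact/exp_domainP.
  - exact/calEP/small_exp.
  - exact/calEP.
  - exact: zu.
  - exact: im.
move=> zu; split=> [z1|/calEP su Zpos].
  have h0 : h != 0 by rewrite -(exp_eq1 sh).
  apply: (card_subset_family (P := fun M v => v = scaled_indicator h M)).
    by move=> M _; exists (scaled_indicator h M); split=> // v ->.
  by move=> M M' v _ _ ->; exact: scaled_indicator_inj.
have exP (M : {set 'I_q}) : #|M| = m -> exists! mu, gibbs_measure_ind (x0 := x0) R J h M mu.
  move=> Mm; have suM := su; have zuM := zu; rewrite -Mm in suM zuM.
  have ZM n := Zpos M n Mm.
  have [mu im] := gibbs_measure_ind_exists R sJ k0 i0 sh suM zuM ZM.
  exists mu; split=> [|mu' im']; first exact: im.
  exact: (gibbs_measure_ind_unique sJ k0 i0 sh suM zuM im im').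
split=> [M Mm|z1].
  by split; [exact: exP|move=> mu; exact: gibbs_measure_ind_TI].
apply: (card_subset_family exP) => M M' mu Mm Mm'.
exact: (gibbs_measure_ind_inj sJ sh k0 Mm Mm' su zu z1 Zpos).
Qed.
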